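(* Let $p$ be a prime, let $k$ be a finite extension of the $p$-adic field $\mathbb{Q}_p$, and let $G=\mathrm{PGL}_2$ over $k$. Then the group $\Gamma=G(k[x,x^{-1}])$ has property (FC), i.e. $\Gamma$ has only finitely many conjugacy classes of finite subgroups.
   Context: A group has property (FC) if it has finitely many conjugacy classes of finite subgroups. *)

(* Defs.v *)
From HB Require Import structures.
From mathcomp Require Import all_boot all_algebra all_field.
From mathcomp Require Import boolp classical_sets functions cardinality.
Set Implicit Arguments.
Unset Strict Implicit.
Unset Printing Implicit Defensive.
Import GRing.Theory.
Local Open Scope ring_scope.
Local Open Scope quotient_scope.

(* The inverse limit of the rings Z/p^n: [x n] is the representative in
   [0, p^n) of the residue of x modulo p^n, so that the single condition below
   expresses both the bound on [x n] and the compatibility of the residues. *)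
Record padic_int (p : nat) (p_pr : prime p) := PadicInt {
  residue :> nat -> nat;
  _ : `[< forall n, residue n = residue n.+1 %% p ^ n >]%N }.

Section PadicIntegers.
Variables (p : nat) (p_pr : prime p).

Local Notation padic_int := (padic_int p_pr).
HB.instance Definition _ := [isSub for @residue p p_pr].
HB.instance Definition _ := [Choice of padic_int by <:].

Implicit Types x y z : padic_int.

Lemma residueS x n : x n = (x n.+1 %% p ^ n)%N.
Proof. by case: x => f /= /asboolP. Qed.

Lemma residue_mod x n : (x n %% p ^ n = x n)%N.
Proof. by rewrite residueS modn_mod. Qed.

Lemma residue_le x m n : (m <= n)%N -> x m = (x n %% p ^ m)%N.
Proof.
move/subnK <-; elim: (n - m)%N => [|d IHd]; first by rewrite residue_mod.
by rewrite IHd residueS modn_dvdm// dvdn_exp2l// leq_addl.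
Qed.

Lemma padic_intP x y : (forall n, x n = y n) -> x = y.
Proof. by move=> xy; apply: val_inj; apply: funext. Qed.

Lemma padic_int_subproof (f : nat -> nat) :
  (forall n, f n = f n.+1 %[mod p ^ n])%N ->
  `[< forall n, f n %% p ^ n = (f n.+1 %% p ^ n.+1) %% p ^ n >]%N.
Proof. by move=> fP; apply/asboolP => n; rewrite modn_dvdm ?fP ?dvdn_exp2l. Qed.

Definition padic_of f fP : padic_int :=
  PadicInt p_pr (@padic_int_subproof f fP).

Lemma padic_nat_subproof (a : nat) : (forall n, a = a %[mod p ^ n])%N.
Proof. by []. Qed.

Lemma padic_add_subproof x y n :
  (x n + y n = x n.+1 + y n.+1 %[mod p ^ n])%N.
Proof. by rewrite (residueS x) (residueS y) modnDm. Qed.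

Lemma padic_mul_subproof x y n :
  (x n * y n = x n.+1 * y n.+1 %[mod p ^ n])%N.
Proof. by rewrite (residueS x) (residueS y) modnMm. Qed.

Lemma residue_lt x n : (x n < p ^ n)%N.
Proof. by rewrite -residue_mod ltn_pmod// expn_gt0 prime_gt0. Qed.

Lemma padic_opp_subproof x n :
  (p ^ n - x n = p ^ n.+1 - x n.+1 %[mod p ^ n])%N.
Proof.
apply/eqP; rewrite -(eqn_modDr (x n.+1)) subnK ?(ltnW (residue_lt _ _))//.
rewrite -modnDmr -residueS subnK ?(ltnW (residue_lt _ _))//.
by rewrite expnS modnMl modnn.
Qed.

Definition padic_zero := padic_of (padic_nat_subproof 0).
Definition padic_one := padic_of (padic_nat_subproof 1).
Definition padic_add x y := padic_of (padic_add_subproof x y).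
Definition padic_mul x y := padic_of (padic_mul_subproof x y).
Definition padic_opp x := padic_of (padic_opp_subproof x).

Lemma padic_addA : associative padic_add.
Proof. by move=> x y z; apply: padic_intP => n /=; rewrite modnDmr modnDml addnA. Qed.

Lemma padic_addC : commutative padic_add.
Proof. by move=> x y; apply: padic_intP => n /=; rewrite addnC. Qed.

Lemma padic_add0 : left_id padic_zero padic_add.
Proof. by move=> x; apply: padic_intP => n /=; rewrite mod0n residue_mod. Qed.

Lemma padic_addN : left_inverse padic_zero padic_opp padic_add.
Proof.
move=> x; apply: padic_intP => n /=.
by rewrite modnDml subnK ?(ltnW (residue_lt _ _))// modnn mod0n.
Qed.

HB.instance Definition _ := GRing.isZmodule.Build padic_int
  padic_addA padic_addC padic_add0 padic_addN.

Lemma padic_mulA : associative padic_mul.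
Proof. by move=> x y z; apply: padic_intP => n /=; rewrite modnMmr modnMml mulnA. Qed.

Lemma padic_mulC : commutative padic_mul.
Proof. by move=> x y; apply: padic_intP => n /=; rewrite mulnC. Qed.

Lemma padic_mul1 : left_id padic_one padic_mul.
Proof.
by move=> x; apply: padic_intP => n /=; rewrite modnMml mul1n residue_mod.
Qed.

Lemma padic_mulDl : left_distributive padic_mul padic_add.
Proof.
by move=> x y z; apply: padic_intP => n /=; rewrite modnMml modnDm mulnDl.
Qed.

Lemma padic_one_neq0 : padic_one != 0.
Proof.
apply/eqP => /(congr1 (fun x : padic_int => x 1)) /=.
by rewrite expn1 mod0n modn_small// prime_gt1.
Qed.

HB.instance Definition _ := GRing.Zmodule_isComNzRing.Build padic_int
  padic_mulA padic_mulC padic_mul1 padic_mulDl padic_one_neq0.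

Definition padic_unit : {pred padic_int} :=
  fun x => `[< exists y : padic_int, y * x = 1 >].
Definition padic_inv x : padic_int :=
  if pselect (exists y : padic_int, y * x = 1) is left xV
  then projT1 (cid xV) else x.

Lemma padic_mulVr : {in padic_unit, left_inverse 1 padic_inv *%R}.
Proof.
move=> x /asboolP ux; rewrite /padic_inv; case: pselect => // xV.
by case: cid.
Qed.

Lemma padic_unitP x y : y * x = 1 -> x \in padic_unit.
Proof. by move=> yx1; apply/asboolP; exists y. Qed.

Lemma padic_inv_out : {in [predC padic_unit], padic_inv =1 id}.
Proof.
move=> x /asboolPn nux; rewrite /padic_inv; case: pselect => // xV.
Qed.

HB.instance Definition _ := GRing.ComNzRing_hasMulInverse.Build padic_int
  padic_mulVr padic_unitP padic_inv_out.

Lemma padic_integral x y : x * y = 0 -> (x == 0) || (y == 0).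
Proof.
have nz z : z != 0 -> exists m, forall n, (m <= n)%N -> (logn p (z n) < m)%N /\ (0 < z n)%N.
  move=> z0; have [m zm] : exists m, z m != 0%N.
    apply: contrapT => nz; move/eqP: z0; apply; apply: padic_intP => n.
    rewrite /= mod0n; apply: contrapT => zn; apply: nz.
    by exists n; apply/eqP.
  exists m => n mn; move: zm; rewrite (residue_le z mn) => zm.
  have zn : (0 < z n)%N by case: (z n) zm => //; rewrite mod0n.
  by split=> //; rewrite ltnNge -pfactor_dvdn.
move=> xy0; apply: contrapT => /negP; rewrite negb_or => /andP[/nz[a xa] /nz[b yb]].
have /(congr1 (fun z : padic_int => z (a + b)%N)) /= := xy0.
have [la xp] := xa _ (leq_addr b a); have [lb yp] := yb _ (leq_addl a b).
rewrite mod0n => /eqP; rewrite -/(dvdn _ _) pfactor_dvdn ?muln_gt0 ?xp//.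
by rewrite lognM// leqNgt -addnS leq_add// ltnW.
Qed.

HB.instance Definition _ :=
  GRing.ComUnitRing_isIntegral.Build padic_int padic_integral.

Definition padic : fieldType := {fraction padic_int}.

End PadicIntegers.

Section Laurent.
Variable k : fieldType.

(* k[x, x^-1] as the subring of k(x) of the fractions q / x^n. *)
Definition is_laurent : {pred {fraction {poly k}}} := fun f =>
  `[< exists (q : {poly k}) (n : nat), f = tofrac q / tofrac 'X^n >].

Lemma tofracXn_neq0 n : tofrac 'X^n != 0 :> {fraction {poly k}}.
Proof. by rewrite tofrac_eq0 -size_poly_eq0 size_polyXn. Qed.

Lemma is_laurent_subring : subring_closed is_laurent.
Proof.
split.
- by apply/asboolP; exists 1, 0%N; rewrite expr0 tofrac1 divr1.
- move=> _ _ /asboolP[q [n ->]] /asboolP[r [m ->]]; apply/asboolP.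
  exists (q * 'X^m - r * 'X^n), (n + m)%N.
  by rewrite -mulNr addf_div ?tofracXn_neq0// exprD tofracB !tofracM mulNr.
- move=> _ _ /asboolP[q [n ->]] /asboolP[r [m ->]]; apply/asboolP.
  by exists (q * r), (n + m)%N; rewrite mulf_div exprD !tofracM.
Qed.

HB.instance Definition _ :=
  GRing.isSubringClosed.Build _ is_laurent is_laurent_subring.

Record laurent := Laurent { frac_of :> {fraction {poly k}};
                            _ : frac_of \in is_laurent }.

HB.instance Definition _ := [isSub for frac_of].
HB.instance Definition _ := [Choice of laurent by <:].
HB.instance Definition _ := [SubChoice_isSubComNzRing of laurent by <:].

Definition laurent_unit : {pred laurent} :=
  fun f => (val f != 0) && ((val f)^-1 \in is_laurent).
Definition laurent_inv (f : laurent) : laurent :=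
  if f \in laurent_unit then insubd f (val f)^-1 else f.

Lemma laurent_mulVr : {in laurent_unit, left_inverse 1 laurent_inv *%R}.
Proof.
move=> f uf; rewrite /laurent_inv uf; case/andP: uf => f0 fV.
by apply: val_inj; rewrite rmorphM /= insubdK// mulVf// rmorph1.
Qed.

Lemma laurent_unitP (f g : laurent) : g * f = 1 -> f \in laurent_unit.
Proof.
move=> /(congr1 val); rewrite rmorphM rmorph1 /= => gf1.
have f0 : val f != 0.
  by apply: contra_eqN gf1 => /eqP ->; rewrite mulr0 eq_sym oner_neq0.
rewrite unfold_in f0 /=.
suff -> : (val f)^-1 = val g by exact: valP.
by apply: (mulIf f0); rewrite mulVf// gf1.
Qed.

Lemma laurent_inv_out : {in [predC laurent_unit], laurent_inv =1 id}.
Proof. by move=> f; rewrite inE /laurent_inv => /negbTE ->. Qed.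

HB.instance Definition _ := GRing.ComNzRing_hasMulInverse.Build laurent
  laurent_mulVr laurent_unitP laurent_inv_out.
HB.instance Definition _ :=
  [SubComUnitRing_isSubIntegralDomain of laurent by <:].

End Laurent.

Section GL.
Variables (n : nat) (R : comUnitRingType).

Record GL := MkGL { GL_mx :> 'M[R]_n; _ : GL_mx \in unitmx }.

HB.instance Definition _ := [isSub for GL_mx].
HB.instance Definition _ := [Choice of GL by <:].

Implicit Types A B C : GL.

Lemma GL_unitmx A : GL_mx A \in unitmx. Proof. exact: (valP A). Qed.

Lemma GL_mul_subproof A B : GL_mx A *m GL_mx B \in unitmx.
Proof. by rewrite unitmx_mul !GL_unitmx. Qed.

Lemma GL_inv_subproof A : invmx (GL_mx A) \in unitmx.
Proof. by rewrite unitmx_inv GL_unitmx. Qed.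

Definition GL_one : GL := MkGL (unitmx1 R n).
Definition GL_mul A B : GL := MkGL (GL_mul_subproof A B).
Definition GL_inv A : GL := MkGL (GL_inv_subproof A).

Lemma GL_mulA : associative GL_mul.
Proof. by move=> A B C; apply: val_inj; rewrite /= mulmxA. Qed.
Lemma GL_mul1 : left_id GL_one GL_mul.
Proof. by move=> A; apply: val_inj; rewrite /= mul1mx. Qed.
Lemma GL_mulr1 : right_id GL_one GL_mul.
Proof. by move=> A; apply: val_inj; rewrite /= mulmx1. Qed.
Lemma GL_mulV : left_inverse GL_one GL_inv GL_mul.
Proof. by move=> A; apply: val_inj; rewrite /= mulVmx ?GL_unitmx. Qed.
Lemma GL_mulrV : right_inverse GL_one GL_inv GL_mul.
Proof. by move=> A; apply: val_inj; rewrite /= mulmxV ?GL_unitmx. Qed.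

HB.instance Definition _ :=
  isGroup.Build GL GL_mulA GL_mul1 GL_mulr1 GL_mulV GL_mulrV.

Definition GL_scal A B : bool :=
  `[< exists2 c : R, c \is a GRing.unit & GL_mx A = c *: GL_mx B >].

Lemma GL_scal_equiv : equiv_class_of GL_scal.
Proof.
split.
- by move=> A; apply/asboolP; exists 1; rewrite ?unitr1 ?scale1r.
- have sym A B : GL_scal A B -> GL_scal B A.
    move=> /asboolP[c uc AB]; apply/asboolP; exists c^-1; rewrite ?unitrV//.
    by rewrite AB scalerA mulVr// scale1r.
  by move=> A B; apply/idP/idP; apply: sym.
- move=> B A C /asboolP[c uc AB] /asboolP[d ud BC]; apply/asboolP.
  by exists (c * d); rewrite ?unitrM ?uc// AB BC scalerA.
Qed.

Canonical GL_scal_equivRel := EquivRelPack GL_scal_equiv.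

(* PGL_n(R) = GL_n(R) / R^*. For the group scheme PGL_n this is the group of
   R-points as soon as Pic(R) has no n-torsion, in particular when R is a PID
   such as k[x, x^-1]. *)
Definition PGL := {eq_quot GL_scal}.

HB.instance Definition _ : EqQuotient _ GL_scal PGL := EqQuotient.on PGL.
HB.instance Definition _ := Choice.on PGL.

Definition PGL_one : PGL := lift_cst PGL GL_one.
Definition PGL_inv : PGL -> PGL := lift_op1 PGL GL_inv.
Definition PGL_mul : PGL -> PGL -> PGL := lift_op2 PGL GL_mul.

Canonical PGL_one_morph := PiConst PGL_one.

Lemma pi_PGL_inv : {morph \pi_PGL : A / GL_inv A >-> PGL_inv A}.
Proof.
move=> A; unlock PGL_inv; apply/eqmodP/asboolP.
have /eqmodP/asboolP[c uc AE] : repr (\pi_PGL A) = A %[mod PGL].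
  by rewrite reprK.
exists c; rewrite //= AE invmxZ ?scalerA ?mulrV ?scale1r//.
by rewrite unitmxZ ?GL_unitmx.
Qed.
Canonical pi_PGL_inv_morph := PiMorph1 pi_PGL_inv.

Lemma pi_PGL_mul : {morph \pi_PGL : A B / GL_mul A B >-> PGL_mul A B}.
Proof.
move=> A B; unlock PGL_mul; apply/eqmodP/asboolP.
have /eqmodP/asboolP[c uc AE] : A = repr (\pi_PGL A) %[mod PGL].
  by rewrite reprK.
have /eqmodP/asboolP[d ud BE] : B = repr (\pi_PGL B) %[mod PGL].
  by rewrite reprK.
exists (c * d); rewrite ?unitrM ?uc//= {1}AE {1}BE.
by rewrite -scalemxAl -scalemxAr scalerA.
Qed.
Canonical pi_PGL_mul_morph := PiMorph2 pi_PGL_mul.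

Lemma PGL_mulA : associative PGL_mul.
Proof. by elim/quotW=> A; elim/quotW=> B; elim/quotW=> C; rewrite !piE GL_mulA. Qed.
Lemma PGL_mul1 : left_id PGL_one PGL_mul.
Proof. by elim/quotW=> A; rewrite !piE GL_mul1. Qed.
Lemma PGL_mulr1 : right_id PGL_one PGL_mul.
Proof. by elim/quotW=> A; rewrite !piE GL_mulr1. Qed.
Lemma PGL_mulV : left_inverse PGL_one PGL_inv PGL_mul.
Proof. by elim/quotW=> A; rewrite !piE GL_mulV. Qed.
Lemma PGL_mulrV : right_inverse PGL_one PGL_inv PGL_mul.
Proof. by elim/quotW=> A; rewrite !piE GL_mulrV. Qed.

HB.instance Definition _ :=
  isGroup.Build PGL PGL_mulA PGL_mul1 PGL_mulr1 PGL_mulV PGL_mulrV.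

End GL.

Section FC.
Local Open Scope classical_set_scope.
Variable G : groupType.

Definition finite_subgroup (H : set G) : Prop :=
  finite_set H /\ group_closed [in H].

Definition conj_class (H : set G) : set (set G) :=
  range (fun g : G => [set (h ^ g)%g | h in H]).

Definition property_FC : Prop :=
  finite_set [set conj_class H | H in [set H | finite_subgroup H]].

End FC.

(* Main.v *)
(* Let R = k[x, x^-1]. For A in GL_2(R) of finite order modulo scalars, the
   number tr(A)^2 / det(A) is one of finitely many constants: it is 2 plus the
   trace of a torsion element of SL_2, hence integral over k, hence in k, and the
   orders of torsion matrices over Q_p of a given size are bounded. Since
   R^* / R^*2 is finite, every element of a finite subgroup H has a lift whose
   determinant and trace range over a finite set.
   If two lifts A1, A2 do not commute, the discriminant of (A1, A2) is nonzero by
   finiteness of the order of their commutator, and it is a constant times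
   det(A1) det(A2), so it is a unit. Then A1 and A2 generate M_2(R) as an
   R-algebra, (A1, A2) is determined up to GL_2(R)-conjugacy by the traces of A1,
   A2, A1 A2 and their determinants, and any further element A of H is determined
   by tr A, tr A A1, tr A A2, tr A A1 A2. If all lifts commute, one nontrivial
   element A1 of H plays the same role: its conjugacy class is determined by trace
   and determinant because a binary quadratic form over R whose discriminant is a
   unit represents a unit (Gauss reduction). *)
From HB Require Import structures.
Require Import Defs.
From mathcomp Require Import all_boot all_algebra all_field.
From mathcomp Require Import boolp classical_sets functions cardinality.
From mathcomp Require Import ring zify.
Set Implicit Arguments.
Unset Strict Implicit.
Unset Printing Implicit Defensive.
Import GRing.Theory VectorInternalTheory.
Local Open Scope classical_set_scope.
Local Open Scope ring_scope.

(** * Conjugacy of pairs of 2x2 matrices *)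

Section TwoByTwo.
Variable R : comUnitRingType.
Implicit Types (a b c d e x : R) (A B P : 'M[R]_2).

(** The order of [H] is never bounded: [H] is conjugated into one of finitely many finite sets cut
    out by trace conditions, and these have finitely many subsets. The obstacle is that matrices
    must be conjugate over [R], not just over its fraction field. A pair is first moved so that one
    combination of its traceless parts becomes [diag(1, -1)]. Gauss reduction supplies this
    conjugation; after it only a diagonal matrix remains to be found. The torsion element of SL_2 is
    [A^2 / det A], so no square root of the determinant is needed. Unless it is scalar, its trace is
    a zero of a monic Chebyshev polynomial. Such traces are finite in number because a 2x2 companion
    matrix over [k] is a larger matrix over Q_p, torsion over Q_p can be conjugated into Z_p, and
    reduction modulo p^2 has torsion-free kernel (modulo p this fails for p = 2). For [k^* / k^*2],
    a Z_p-lattice closed under products stands in for the ring of integers of [k], and compactness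
    of Z_p^d stands in for completeness and finiteness of the residue field. *)

Definition mx2 a b c d : 'M[R]_2 :=
  \matrix_(i, j) if i == 0 then (if j == 0 then a else b)
                 else (if j == 0 then c else d).

Lemma mx2P A B : A 0 0 = B 0 0 -> A 0 1 = B 0 1 -> A 1 0 = B 1 0 ->
  A 1 1 = B 1 1 -> A = B.
Proof.
move=> h00 h01 h10 h11; apply/matrixP => i j.
have cases (l : 'I_2) : l = 0 \/ l = 1.
  by case: l => [[|[|//]] l2]; [left | right]; apply: val_inj.
by case: (cases i) => ->; case: (cases j) => ->.
Qed.

Lemma mx2_eta A : A = mx2 (A 0 0) (A 0 1) (A 1 0) (A 1 1).
Proof. by apply: mx2P; rewrite !mxE. Qed.

Lemma mx2_ind (T : 'M[R]_2 -> Prop) :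
  (forall a b c d, T (mx2 a b c d)) -> forall A, T A.
Proof. by move=> TA A; rewrite (mx2_eta A). Qed.

Lemma mx2_inj a b c d a' b' c' d' :
  mx2 a b c d = mx2 a' b' c' d' -> [/\ a = a', b = b', c = c' & d = d'].
Proof.
move=> h; split; [have := congr1 (fun A => A 0 0) h
  | have := congr1 (fun A => A 0 1) h | have := congr1 (fun A => A 1 0) h
  | have := congr1 (fun A => A 1 1) h]; by rewrite !mxE.
Qed.

Lemma mx2_scalar a : a%:M = mx2 a 0 0 a.
Proof. by apply: mx2P; rewrite !mxE. Qed.

Lemma mx2D a b c d a' b' c' d' :
  mx2 a b c d + mx2 a' b' c' d' = mx2 (a + a') (b + b') (c + c') (d + d').
Proof. by apply: mx2P; rewrite !mxE. Qed.

Lemma mx2N a b c d : - mx2 a b c d = mx2 (- a) (- b) (- c) (- d).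
Proof. by apply: mx2P; rewrite !mxE. Qed.

Lemma mx2Z x a b c d : x *: mx2 a b c d = mx2 (x * a) (x * b) (x * c) (x * d).
Proof. by apply: mx2P; rewrite !mxE. Qed.

Lemma mx2M a b c d a' b' c' d' :
  mx2 a b c d *m mx2 a' b' c' d' =
  mx2 (a * a' + b * c') (a * b' + b * d') (c * a' + d * c') (c * b' + d * d').
Proof. by apply: mx2P; rewrite !mxE !big_ord_recl big_ord0 !mxE /= addr0. Qed.

Lemma mx2_tr a b c d : \tr (mx2 a b c d) = a + d.
Proof. by rewrite /mxtrace !big_ord_recl big_ord0 !mxE /= addr0. Qed.

Lemma mx2_det a b c d : \det (mx2 a b c d) = a * d - b * c.
Proof.
rewrite (expand_det_row _ ord0) !big_ord_recl big_ord0 /cofactor !det_mx11.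
by rewrite !mxE /= /bump /=; ring.
Qed.

Definition mx2E := (mx2_scalar, mx2M, mx2Z, mx2N, mx2D, mx2_tr, mx2_det).

Lemma mx2_unit a b c d : (mx2 a b c d \in unitmx) = (a * d - b * c \is a GRing.unit).
Proof. by rewrite unitmxE mx2_det. Qed.

Lemma traceless_mx2 A : \tr A = 0 -> exists e b c, A = mx2 e b c (- e).
Proof.
elim/mx2_ind: A => a b c d; rewrite mx2_tr => /eqP; rewrite addrC addr_eq0 => /eqP ->.
by exists a, b, c.
Qed.

(* The canonical traceless matrix of square [x]. *)
Definition antidiag x := mx2 0 x 1 0.

End TwoByTwo.

Section Pairs.
Variable R : idomainType.
Hypothesis unit2 : (2 : R) \is a GRing.unit.
Hypothesis conj_antidiag : forall e b c : R, e ^+ 2 + b * c \is a GRing.unit ->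
  exists2 P, P \in unitmx &
    P *m mx2 e b c (- e) = antidiag (e ^+ 2 + b * c) *m P.

Let nz2 : (2 : R) != 0.
Proof. by apply: contraTneq unit2 => ->; rewrite unitr0. Qed.

Let H : 'M[R]_2 := mx2 1 0 0 (-1).

(** Trace the relation against the two traceless matrices and their commutator. The commutator is
    orthogonal to both for the trace form, and its square has trace
    [-2 * (4 * n1 * n2 - m ^+ 2)]. *)
Lemma comb_diag (al be ga e1 b1 c1 e2 b2 c2 : R) :
  al * e1 + be * e2 + ga * (e1 * e2 + b1 * c2 - (e2 * e1 + b2 * c1)) = 1 ->
  al * b1 + be * b2 + ga * (e1 * b2 + b1 * - e2 - (e2 * b1 + b2 * - e1)) = 0 ->
  al * c1 + be * c2 + ga * (c1 * e2 + - e1 * c2 - (c2 * e1 + - e2 * c1)) = 0 ->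
  al * - e1 + be * - e2
    + ga * (c1 * b2 + - e1 * - e2 - (c2 * b1 + - e2 * - e1)) = -1 ->
  let n1 := e1 ^+ 2 + b1 * c1 in let n2 := e2 ^+ 2 + b2 * c2 in
  let m := 2 * e1 * e2 + b1 * c2 + c1 * b2 in
  [/\ 2 * e1 = 2 * al * n1 + be * m, 2 * e2 = 2 * be * n2 + al * m &
      b1 * c2 - c1 * b2 = - ga * (4 * n1 * n2 - m ^+ 2)].
Proof.
move=> E00 E01 E10 E11 n1 n2 m.
move: E00 E01 E10 E11; set a00 := (X in X = _) => E00; set a01 := (X in X = _) => E01.
set a10 := (X in X = _) => E10; set a11 := (X in X = _) => E11.
rewrite /n1 /n2 /m; split.
- transitivity (a00 * e1 + a01 * c1 + a10 * b1 - a11 * e1).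
    by rewrite E00 E01 E10 E11; ring.
  by rewrite /a00 /a01 /a10 /a11; ring.
- transitivity (a00 * e2 + a01 * c2 + a10 * b2 - a11 * e2).
    by rewrite E00 E01 E10 E11; ring.
  by rewrite /a00 /a01 /a10 /a11; ring.
apply: (mulfI nz2).
transitivity (a00 * (b1 * c2 - c1 * b2) + a01 * 2 * (c1 * e2 - e1 * c2)
   + a10 * 2 * (e1 * b2 - e2 * b1) - a11 * (b1 * c2 - c1 * b2)).
  by rewrite E00 E01 E10 E11; ring.
by rewrite /a00 /a01 /a10 /a11; ring.
Qed.

(* With [H] common to both pairs, the diagonal entries and the products of
   off-diagonal entries agree, so a diagonal matrix conjugates. *)
Lemma conj_pair_diag (al be ga e1 b1 c1 e2 b2 c2 e1' b1' c1' e2' b2' c2' : R) :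
  let B1 := mx2 e1 b1 c1 (- e1) in let B2 := mx2 e2 b2 c2 (- e2) in
  let B1' := mx2 e1' b1' c1' (- e1') in let B2' := mx2 e2' b2' c2' (- e2') in
  e1 ^+ 2 + b1 * c1 = e1' ^+ 2 + b1' * c1' ->
  e2 ^+ 2 + b2 * c2 = e2' ^+ 2 + b2' * c2' ->
  2 * e1 * e2 + b1 * c2 + c1 * b2 = 2 * e1' * e2' + b1' * c2' + c1' * b2' ->
  4 * (e1 ^+ 2 + b1 * c1) * (e2 ^+ 2 + b2 * c2)
    - (2 * e1 * e2 + b1 * c2 + c1 * b2) ^+ 2 \is a GRing.unit ->
  al *: B1 + be *: B2 + ga *: (B1 *m B2 - B2 *m B1) = H ->
  al *: B1' + be *: B2' + ga *: (B1' *m B2' - B2' *m B1') = H ->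
  exists2 P, P \in unitmx & P *m B1 = B1' *m P /\ P *m B2 = B2' *m P.
Proof.
move=> /= n1E n2E mE uD; rewrite !mx2E /H.
move=> /mx2_inj[h00 h01 h10 h11] /mx2_inj[h00' h01' h10' h11'].
have /= [] := comb_diag h00 h01 h10 h11.
move=> e1E e2E wE.
have /= [] := comb_diag h00' h01' h10' h11'.
rewrite -n1E -n2E -mE -e1E -e2E -wE => /(mulfI nz2) e1q /(mulfI nz2) e2q wq.
subst e1' e2'; move: n1E n2E mE => /addrI n1E /addrI n2E; rewrite -!addrA => /addrI mE.
have b1c2 : b1 * c2 = b1' * c2'.
  apply: (mulfI nz2); have -> : 2 * (b1 * c2) = (b1 * c2 + c1 * b2) + (b1 * c2 - c1 * b2) by ring.
  by rewrite mE -wq; ring.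
have b2c1 : b2 * c1 = b2' * c1'.
  apply: (mulfI nz2); have -> : 2 * (b2 * c1) = (b1 * c2 + c1 * b2) - (b1 * c2 - c1 * b2) by ring.
  by rewrite mE -wq; ring.
move: uD; set D := _ - _ => uD; pose w := b1 * c2 - c1 * b2.
pose u := e1 * b2 - e2 * b1; pose v := e1 * c2 - e2 * c1.
have DE : D = - w ^+ 2 + 4 * u * v by rewrite /D /w /u /v; ring.
(* [w] and [u] lie in the ideal of [b1, b2], while [w] and [v] lie in that of [c1, c2]; so the unit
   [D] makes both pairs unimodular. This defines the ratio [la] without dividing by an entry. *)
pose s1 := (- w * c2 - 4 * e2 * v) / D; pose s2 := (w * c1 + 4 * e1 * v) / D.
have sE : s1 * b1 + s2 * b2 = 1.
  rewrite /s1 /s2 -[RHS](mulrV uD) {3}DE /u /w; ring.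
pose t1 := (w * b2 - 4 * e2 * u) / D; pose t2 := (- w * b1 + 4 * e1 * u) / D.
have tE : t1 * c1 + t2 * c2 = 1.
  rewrite /t1 /t2 -[RHS](mulrV uD) {3}DE /v /w; ring.
pose la := s1 * b1' + s2 * b2'.
have c1E : c1 = la * c1'.
  rewrite -[LHS]mul1r -sE /la !mulrDl -!mulrA (mulrC b1) (mulrC b1').
  by rewrite b2c1 (mulrC c1) n1E; ring.
have c2E : c2 = la * c2'.
  rewrite -[LHS]mul1r -sE /la !mulrDl -!mulrA.
  by rewrite b1c2 n2E.
have b1E : b1' = la * b1.
  rewrite -[LHS]mul1r -tE {1}c1E {1}c2E.
  rewrite -[RHS]mul1r -tE.
  transitivity (t1 * la * (b1' * c1') + t2 * la * (b1' * c2')); first by ring.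
  by rewrite -n1E -b1c2; ring.
have b2E : b2' = la * b2.
  rewrite -[LHS]mul1r -tE {1}c1E {1}c2E.
  rewrite -[RHS]mul1r -tE.
  transitivity (t1 * la * (b2' * c1') + t2 * la * (b2' * c2')); first by ring.
  by rewrite -n2E -b2c1; ring.
have ula : la \is a GRing.unit.
  apply/unitrP; exists (t1 * c1' + t2 * c2').
  have lam : la * (t1 * c1' + t2 * c2') = 1 by rewrite -tE {1}c1E {1}c2E; ring.
  by split; rewrite // mulrC.
exists (mx2 la 0 0 1); first by rewrite mx2_unit mulr1 mulr0 subr0.
by rewrite !mx2M c1E c2E b1E b2E; split; congr mx2; ring.
Qed.

(** The unit Gram determinant makes [H] a combination of [B1], [B2] and their commutator. The same
    combination of the primed pair has the same determinant, hence square 1, and is conjugate to [H]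
    by [conj_antidiag]; then [conj_pair_diag] applies. *)
Lemma conj_pair (e1 b1 c1 e2 b2 c2 e1' b1' c1' e2' b2' c2' : R) :
  let B1 := mx2 e1 b1 c1 (- e1) in let B2 := mx2 e2 b2 c2 (- e2) in
  let B1' := mx2 e1' b1' c1' (- e1') in let B2' := mx2 e2' b2' c2' (- e2') in
  e1 ^+ 2 + b1 * c1 = e1' ^+ 2 + b1' * c1' ->
  e2 ^+ 2 + b2 * c2 = e2' ^+ 2 + b2' * c2' ->
  2 * e1 * e2 + b1 * c2 + c1 * b2 = 2 * e1' * e2' + b1' * c2' + c1' * b2' ->
  4 * (e1 ^+ 2 + b1 * c1) * (e2 ^+ 2 + b2 * c2)
    - (2 * e1 * e2 + b1 * c2 + c1 * b2) ^+ 2 \is a GRing.unit ->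
  exists2 P, P \in unitmx & P *m B1 = B1' *m P /\ P *m B2 = B2' *m P.
Proof.
move=> B1 B2 B1' B2'.
set n1 := _ + b1 * c1; set n2 := _ + b2 * c2; set m := _ + c1 * b2.
set n1' := _ + b1' * c1'; set n2' := _ + b2' * c2'; set m' := _ + c1' * b2'.
move=> n1E n2E mE; set D := 4 * _ * _ - _ => uD.
(* The relations of [comb_diag] solved for the coefficients, with [D] as denominator. *)
pose al := (4 * e1 * n2 - 2 * e2 * m) / D; pose be := (4 * e2 * n1 - 2 * e1 * m) / D.
pose ga := - (b1 * c2 - c1 * b2) / D.
have HE : al *: B1 + be *: B2 + ga *: (B1 *m B2 - B2 *m B1) = H.
  rewrite /H !mx2E; have {1 2}-> : 1 = D / D by rewrite mulrV.
  by rewrite /al /be /ga /D /n1 /n2 /m; congr mx2; ring.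
pose H' := al *: B1' + be *: B2' + ga *: (B1' *m B2' - B2' *m B1').
have [eH [bH [cH H'E]]] : exists e b c, H' = mx2 e b c (- e).
  by apply: traceless_mx2; rewrite /H' !mx2E; ring.
have H'1 : eH ^+ 2 + bH * cH = 1.
  have : \det H' = \det H.
    transitivity (- (al ^+ 2 * n1' + be ^+ 2 * n2' + al * be * m'
      - ga ^+ 2 * (4 * n1' * n2' - m' ^+ 2))).
      by rewrite /H' !mx2E /n1' /n2' /m'; ring.
    by rewrite -n1E -n2E -mE -HE !mx2E /n1 /n2 /m; ring.
  rewrite H'E /H !mx2E => e; apply: oppr_inj; rewrite -[RHS](mulrN1 1).
  by transitivity (1 * -1 - 0 * 0 : R); [rewrite -e; ring | ring].
have [P uP PH'] := conj_antidiag (e := eH) (b := bH) (c := cH) ltac:(by rewrite H'1 unitr1).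
have [Q uQ QH] := conj_antidiag (e := 1) (b := 0) (c := 0)
  ltac:(by rewrite mulr0 addr0 expr1n unitr1).
rewrite -H'E H'1 in PH'; rewrite mulr0 addr0 expr1n -/H in QH.
pose S := invmx Q *m P; have uS : S \in unitmx by rewrite unitmx_mul unitmx_inv uQ.
have SH : S *m H' = H *m S.
  rewrite /S -mulmxA PH' !mulmxA; congr (_ *m P).
  by rewrite -[H](mulKmx uQ) QH -!mulmxA mulmxV // mulmx1.
clearbody S; pose cj X := S *m X *m invmx S.
have cjK X : S *m X = cj X *m S by rewrite /cj mulmxKV.
have cjM X Y : cj (X *m Y) = cj X *m cj Y.
  by rewrite /cj !mulmxA mulmxKV.
have cjD X Y : cj (X + Y) = cj X + cj Y by rewrite /cj mulmxDr mulmxDl.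
have cjN X : cj (- X) = - cj X by rewrite /cj mulmxN mulNmx.
have cjZ x X : cj (x *: X) = x *: cj X by rewrite /cj -scalemxAr -scalemxAl.
have cjH : cj H' = H by rewrite /cj SH mulmxK.
have trcj X : \tr (cj X) = \tr X by rewrite /cj mxtrace_mulC mulmxA mulVmx // mul1mx.
have detcj X : \det (cj X) = \det X.
  by rewrite /cj !det_mulmx mulrC mulrA -det_mulmx mulVmx // det1 mul1r.
have [f1 [g1 [h1 F1]]] : exists e b c, cj B1' = mx2 e b c (- e).
  by apply: traceless_mx2; rewrite trcj mx2_tr; ring.
have [f2 [g2 [h2 F2]]] : exists e b c, cj B2' = mx2 e b c (- e).
  by apply: traceless_mx2; rewrite trcj mx2_tr; ring.
have n1F : f1 ^+ 2 + g1 * h1 = n1'.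
  transitivity (- \det (cj B1')); first by rewrite F1 mx2_det; ring.
  by rewrite detcj mx2_det /n1'; ring.
have n2F : f2 ^+ 2 + g2 * h2 = n2'.
  transitivity (- \det (cj B2')); first by rewrite F2 mx2_det; ring.
  by rewrite detcj mx2_det /n2'; ring.
have mF : 2 * f1 * f2 + g1 * h2 + h1 * g2 = m'.
  transitivity (\tr (cj (B1' *m B2'))); first by rewrite cjM F1 F2 !mx2E; ring.
  by rewrite trcj !mx2E /m'; ring.
have [] := @conj_pair_diag al be ga e1 b1 c1 e2 b2 c2 f1 g1 h1 f2 g2 h2.
- by rewrite n1F.
- by rewrite n2F.
- by rewrite mF.
- by [].
- exact: HE.
- by rewrite -F1 -F2 -cjH /H' !cjD !cjZ cjD cjN !cjM.
move=> T uT [T1 T2]; exists (invmx S *m T); first by rewrite unitmx_mul unitmx_inv uS.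
have back X Y : invmx S *m (cj X *m Y) = X *m (invmx S *m Y).
  by rewrite /cj !mulmxA mulVmx // mul1mx.
by rewrite -!mulmxA T1 T2 -F1 -F2 !back.
Qed.

End Pairs.

(** * Finite subgroups of PGL_2 over a domain *)

Lemma finite_subsets (T : choiceType) (F : set T) :
  finite_set F -> finite_set [set S | S `<=` F].
Proof.
move=> /finite_seqP[s ->]; case: s => [|x0 s].
  apply: (@sub_finite_set _ _ [set set0]); last exact: finite_set1.
  by move=> S /= S0; apply/seteqP; split=> // x /S0.
set s' := x0 :: s.
pose f (J : {set 'I_(size s')}) : set T := [set nth x0 s' j | j in [set` J]].
apply: (@sub_finite_set _ _ [set f J | J in setT]).
  move=> S /= Ss; exists [set j : 'I_(size s') | `[< S (nth x0 s' j) >]]%SET => //.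
  apply/seteqP; split=> [x [j]|x Sx].
    by rewrite /= inE => /asboolP Sj <-.
  have xs : (index x s' < size s')%N by rewrite index_mem; apply: Ss.
  exists (Ordinal xs); last by rewrite nth_index // -index_mem.
  by rewrite /= inE; apply/asboolP; rewrite nth_index // -index_mem.
by apply: finite_image; exact: finite_finset.
Qed.

(** A conjugacy class is determined by any one member, and finitely many finite sets have finitely
    many subsets. The sets in [FF] may thus be arbitrary, not subgroups. *)
Lemma property_FC_of_cover (G : groupType) (FF : set (set G)) :
  finite_set FF -> (forall F, FF F -> finite_set F) ->
  (forall H : set G, finite_subgroup H ->
     exists g, exists2 F, FF F & forall h, H h -> F (h ^ g)%g) ->
  property_FC G.
Proof.
move=> finFF finF cover.
apply: (@sub_finite_set _ _
  [set conj_class S | S in \bigcup_(F in FF) [set S | S `<=` F]]); last first.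
  by apply/finite_image/bigcup_finite => // F /finF; exact: finite_subsets.
move=> _ [H /= finH <-]; have [g [F FFF HF]] := cover H finH.
exists [set (h ^ g)%g | h in H].
  by exists F => // _ [h Hh <-]; exact: HF.
rewrite /conj_class; apply/seteqP; split=> _ [x _ <-].
  exists (g * x)%g => //; apply/seteqP; split=> [_ [h Hh <-]|_ [_ [h Hh <-] <-]].
    by exists (h ^ g)%g; [exists h | rewrite conjgM].
  by exists h => //; rewrite conjgM.
exists (g^-1 * x)%g => //; apply/seteqP; split=> [_ [_ [h Hh <-] <-]|_ [h Hh <-]].
  by exists h => //; rewrite -conjgM mulgA mulgV mul1g.
by exists (h ^ g)%g; [exists h | rewrite -conjgM mulgA mulgV mul1g].
Qed.

Lemma finite_subgroup_torsion (G : groupType) (H : set G) (h : G) :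
  finite_subgroup H -> H h -> exists n, (h ^+ n.+1 = 1)%g.
Proof.
move=> [/finite_seqP[s HE] Hg] Hh.
have [H1 HM] : 1%g \in [in H] /\ mulg_closed [in H].
  by split; [case: Hg | exact: group_closedM].
have Hn n : (h ^+ n)%g \in s.
  suff : H (h ^+ n)%g by rewrite HE.
  elim: n => [|n IHn]; first by move: H1; rewrite expg0 => /set_mem.
  rewrite expgS; apply: set_mem; apply: HM; exact/mem_set.
pose f (i : 'I_(size s).+1) := (h ^+ i)%g.
have /injectivePn[i [j ij fij]] : ~~ injectiveb f.
  apply/negP => /injectiveP inj.
  have : (size (map f (enum 'I_(size s).+1)) <= size s)%N.
    apply: uniq_leq_size; last by move=> _ /mapP[i _ ->]; exact: Hn.
    by rewrite (map_inj_uniq inj) enum_uniq.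
  by rewrite size_map size_enum_ord ltnn.
wlog ltij : i j ij fij / (i < j)%N.
  move=> W; case: (ltngtP i j) => [|ji|/val_inj e]; first exact: W.
    by apply: (W j i) => //; rewrite eq_sym.
  by rewrite e eqxx in ij.
exists (j - i).-1; rewrite prednK ?subn_gt0 //.
apply: (@mulgI _ (h ^+ i)%g); rewrite mulg1 -expgnDr subnKC 1?ltnW //.
Qed.

Section Torsion.
Variable R : idomainType.
Hypothesis char0 : forall n, (n.+1%:R : R) != 0.
Implicit Types A B : 'M[R]_2.

Definition scalar_power A := exists n c, A ^+ n.+1 = c%:M.

Let nz2 : (2 : R) != 0. Proof. exact: char0 1. Qed.

Lemma exprD_sq0 (t : R) B n : B *m B = 0 ->
  (t%:M + B) ^+ n.+1 = (t ^+ n.+1)%:M + (n.+1%:R * t ^+ n) *: B.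
Proof.
move=> B0; elim: n => [|n IHn]; first by rewrite !expr1 expr0 mulr1 scale1r.
rewrite exprS IHn mulrDl !mulrDr -!mulmxE -scalar_mxM -exprS.
rewrite -!scalemxAr B0 scaler0 addr0 mul_scalar_mx mul_mx_scalar scalerA -addrA.
by congr (_ + _); rewrite -scalerDl; congr (_ *: _); rewrite [in RHS]mulrSr exprS; ring.
Qed.

(* [2 A - tr A] squares to the discriminant, hence to zero, so [A] is unipotent
   up to a scalar and cannot have finite order modulo scalars. *)
Lemma torsion_disc0 A : \det A \is a GRing.unit -> scalar_power A ->
  (\tr A) ^+ 2 = 4 * \det A -> exists a, A = a%:M.
Proof.
elim/mx2_ind: A => a b c d; rewrite !mx2E => uA [n [x Ax]] disc.
pose B := mx2 (a - d) (2 * b) (2 * c) (d - a).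
have AE : 2 *: mx2 a b c d = (a + d)%:M + B.
  by rewrite /B !mx2E; congr mx2; ring.
have B0 : B *m B = 0.
  have z : (a - d) * (a - d) + 2 * b * (2 * c) = 0.
    transitivity ((a + d) ^+ 2 - 4 * (a * d - b * c)); first by ring.
    by rewrite disc subrr.
  apply/mx2P; rewrite /B mx2M !mxE /=; [exact: z | ring | ring | rewrite -z; ring].
have nzt : a + d != 0.
  have n4 : (4 : R) != 0 := char0 3.
  have nzd : a * d - b * c != 0 by apply: contraTneq uA => ->; rewrite unitr0.
  apply/eqP => t0; move/eqP: disc; rewrite t0 expr0n /= eq_sym mulf_eq0.
  by rewrite (negbTE n4) (negbTE nzd).
have := congr1 (fun X => X ^+ n.+1) AE.
rewrite exprD_sq0 // exprZn Ax; set k := _ * _ ^+ n.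
have nzk : k != 0 by rewrite mulf_neq0 ?expf_neq0.
rewrite /B !mx2E => /mx2_inj[e00 e01 e10 e11].
have z2 : 2 * k != 0 by rewrite mulf_neq0.
exists a; rewrite mx2_scalar; congr mx2.
- by apply: (mulfI z2); rewrite mulr0 -(mulr0 (2 ^+ n.+1)) e01; ring.
- by apply: (mulfI z2); rewrite mulr0 -(mulr0 (2 ^+ n.+1)) e10; ring.
apply: (mulfI z2); apply/eqP; rewrite -subr_eq0; apply/eqP.
transitivity (2 ^+ n.+1 * x - 2 ^+ n.+1 * x); last by rewrite subrr.
by rewrite {1}e11 e00; ring.
Qed.

(* Gram determinant of the traceless parts of [2 A1] and [2 A2]; it is equal to
   [4 det (A1 A2 - A2 A1)]. *)
Definition pair_disc A1 A2 :=
  (\tr A1 ^+ 2 - 4 * \det A1) * (\tr A2 ^+ 2 - 4 * \det A2)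
    - (2 * \tr (A1 *m A2) - \tr A1 * \tr A2) ^+ 2.

Lemma adj_mx2 (a b c d : R) : \adj (mx2 a b c d) = mx2 d (- b) (- c) a.
Proof. by apply/mx2P; rewrite !mxE /cofactor det_mx11 !mxE /=; ring. Qed.

(** The product [C] is the commutator times [d = det A1 * det A2], with [det C = d^2] and
    [4 * (tr C - 2 * d) = - pair_disc A1 A2]. If [pair_disc] vanishes, [C] has discriminant zero, so
    torsion makes it scalar, and its trace makes the scalar equal to [d]. *)
Lemma pair_disc0_comm A1 A2 :
  \det A1 \is a GRing.unit -> \det A2 \is a GRing.unit ->
  scalar_power (A1 *m A2 *m \adj A1 *m \adj A2) ->
  pair_disc A1 A2 = 0 -> A1 *m A2 = A2 *m A1.
Proof.
move=> u1 u2 tors D0; set C := _ *m \adj A2 in tors.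
have detC : \det C = (\det A1 * \det A2) ^+ 2.
  have adjE A : \det (\adj A) = \det A.
    by elim/mx2_ind: A => a b c d; rewrite adj_mx2 !mx2E; ring.
  by rewrite /C !det_mulmx !adjE; ring.
have trC : \tr C = 2 * (\det A1 * \det A2).
  apply: (mulfI (char0 3)); apply/eqP; rewrite -subr_eq0; apply/eqP.
  transitivity (- pair_disc A1 A2); last by rewrite D0 oppr0.
  rewrite /C /pair_disc.
  elim/mx2_ind: A1 {u1 tors C detC D0} => a b c d.
  elim/mx2_ind: A2 {u2} => a' b' c' d'.
  by rewrite !adj_mx2 !mx2E; ring.
have [x Cx] : exists x, C = x%:M.
  apply: torsion_disc0 => //; first by rewrite detC unitrX // unitrM u1.
  by rewrite trC detC; ring.
have xE : x = \det A1 * \det A2.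
  by apply: (mulfI nz2); rewrite -trC Cx mx2_scalar mx2_tr; ring.
have CA2 : C *m A2 = \det A2 *: (A1 *m A2 *m \adj A1).
  by rewrite /C -(mulmxA _ (\adj A2)) mul_adj_mx mul_mx_scalar.
have CA12 : C *m A2 *m A1 = (\det A1 * \det A2) *: (A1 *m A2).
  rewrite CA2 -scalemxAl -(mulmxA _ (\adj A1)) mul_adj_mx mul_mx_scalar scalerA.
  by rewrite mulrC.
have ux : x \is a GRing.unit by rewrite xE unitrM u1.
rewrite -[LHS]scale1r -(mulVr ux) -scalerA {2}xE -CA12 Cx -mulmxA mul_scalar_mx.
by rewrite scalerA mulVr // scale1r.
Qed.

(** Over the fraction field the centraliser of [A] is spanned by [1] and [A], and the trace form on
    it is nondegenerate. Hence a matrix commuting with [A] is determined by two traces. *)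
Lemma comm_trace0 A X : (\tr A) ^+ 2 - 4 * \det A != 0 -> X *m A = A *m X ->
  \tr X = 0 -> \tr (X *m A) = 0 -> X = 0.
Proof.
elim/mx2_ind: A => a b c d; rewrite mx2_tr mx2_det => nzD XA /traceless_mx2[x [y [z XE]]]; move: XA.
rewrite XE !mx2E => /mx2_inj[e00 e01 e10 _] t.
have [D00 D01 D10] : [/\ ((a + d) ^+ 2 - 4 * (a * d - b * c)) * x = 0,
   ((a + d) ^+ 2 - 4 * (a * d - b * c)) * y = 0 &
   ((a + d) ^+ 2 - 4 * (a * d - b * c)) * z = 0].
  pose E00 := x * a + y * c - (a * x + b * z).
  pose E01 := x * b + y * d - (a * y + b * - x).
  pose E10 := z * a + - x * c - (c * x + d * z).
  have [E00_0 E01_0 E10_0] : [/\ E00 = 0, E01 = 0 & E10 = 0].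
    by rewrite /E00 /E01 /E10 e00 e01 e10 !subrr.
  pose T := x * a + y * c + (z * b + - x * d); have T0 : T = 0 := t.
  split.
  - transitivity ((a - d) * T + c * E01 - b * E10).
      by rewrite /T /E01 /E10; ring.
    by rewrite T0 E01_0 E10_0; ring.
  - transitivity (2 * b * T - (a - d) * E01 + 2 * b * E00).
      by rewrite /T /E01 /E00; ring.
    by rewrite T0 E00_0 E01_0; ring.
  - transitivity (2 * c * T + (a - d) * E10 - 2 * c * E00).
      by rewrite /T /E10 /E00; ring.
    by rewrite T0 E00_0 E10_0; ring.
have nz u : ((a + d) ^+ 2 - 4 * (a * d - b * c)) * u = 0 -> u = 0.
  by move/eqP; rewrite mulf_eq0 (negbTE nzD) => /eqP.
by rewrite (nz _ D00) (nz _ D01) (nz _ D10); apply/mx2P; rewrite !mxE ?oppr0.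
Qed.

(** Over the fraction field [1], [A1], [A2], [A1 A2] form a basis of the matrix algebra, whose trace
    form is nondegenerate. Hence any matrix is determined by four traces. *)
Lemma pair_trace0 A1 A2 X : pair_disc A1 A2 != 0 -> \tr X = 0 ->
  \tr (X *m A1) = 0 -> \tr (X *m A2) = 0 -> \tr (X *m A1 *m A2) = 0 -> X = 0.
Proof.
elim/mx2_ind: A1 => a b c d; elim/mx2_ind: A2 => a' b' c' d'.
set D := pair_disc _ _ => nzD /traceless_mx2[x [y [z XE]]].
rewrite XE -mulmxA !mx2E => T1 T2 T3.
pose f1 := a * b' + b * d'; pose f2 := c * a' + d * c'.
pose f0 := a * a' + b * c' - (c * b' + d * d').
have T1' : x * (a - d) + y * c + z * b = 0 by rewrite -T1; ring.
have T2' : x * (a' - d') + y * c' + z * b' = 0 by rewrite -T2; ring.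
have T3' : x * f0 + y * f2 + z * f1 = 0 by rewrite -T3 /f0 /f1 /f2; ring.
(* [D] is four times the determinant of the system [T1'], [T2'], [T3'] in [x, y, z]; the three
   identities that follow are Cramer's rule. *)
have DE : D = 4 * ((a - d) * (c' * f1 - b' * f2) - (a' - d') * (c * f1 - b * f2)
   + f0 * (c * b' - b * c')).
  by rewrite /D /pair_disc !mx2E /f0 /f1 /f2; ring.
have nz u : D * u = 0 -> u = 0.
  by move/eqP; rewrite mulf_eq0 (negbTE nzD) => /eqP.
have x0 : x = 0.
  apply: nz; transitivity (4 * ((x * (a - d) + y * c + z * b) * (c' * f1 - b' * f2)
    - (x * (a' - d') + y * c' + z * b') * (c * f1 - b * f2)
    + (x * f0 + y * f2 + z * f1) * (c * b' - b * c'))); first by rewrite DE; ring.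
  by rewrite T1' T2' T3'; ring.
have y0 : y = 0.
  apply: nz; transitivity (4 * (- (x * (a - d) + y * c + z * b) * ((a' - d') * f1 - b' * f0)
    + (x * (a' - d') + y * c' + z * b') * ((a - d) * f1 - b * f0)
    - (x * f0 + y * f2 + z * f1) * ((a - d) * b' - b * (a' - d')))); first by rewrite DE; ring.
  by rewrite T1' T2' T3'; ring.
have z0 : z = 0.
  apply: nz; transitivity (4 * ((x * (a - d) + y * c + z * b) * ((a' - d') * f2 - c' * f0)
    - (x * (a' - d') + y * c' + z * b') * ((a - d) * f2 - c * f0)
    + (x * f0 + y * f2 + z * f1) * ((a - d) * c' - c * (a' - d')))); first by rewrite DE; ring.
  by rewrite T1' T2' T3'; ring.
by rewrite x0 y0 z0; apply/mx2P; rewrite !mxE ?oppr0.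
Qed.

End Torsion.

Lemma finite_section (X : choiceType) (I : Type) (x0 : X) (S : set X) (f : X -> I) :
  finite_set (f @` S) -> exists S', [/\ finite_set S', S' `<=` S &
    forall x, S x -> exists2 y, S' y & f y = f x].
Proof.
move=> finfS; pose g i := xget x0 (S `&` f @^-1` [set i]).
have gP x : S x -> S (g (f x)) /\ f (g (f x)) = f x.
  by move=> Sx; have [] : (S `&` f @^-1` [set f x]) (g (f x))
    by exact: (xgetPex x0 (ex_intro _ x _)).
exists (g @` (f @` S)); split; first exact: finite_image.
  by move=> _ [_ [x Sx <-] <-]; case: (gP x Sx).
move=> x Sx; exists (g (f x)); last by case: (gP x Sx).
by exists (f x) => //; exists x.
Qed.

Lemma finite_set_inj (X : choiceType) (I : Type) (x0 : X) (S : set X) (f : X -> I) :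
  {in S &, injective f} -> finite_set (f @` S) -> finite_set S.
Proof.
move=> finj /(finite_section x0)[S' [finS' S'S SS']].
apply: sub_finite_set finS' => x Sx; have [y S'y /finj] := SS' x Sx.
by move=> <- //; apply/mem_set => //; exact: S'S.
Qed.

(** * Matrix lifts of elements of PGL_2 *)

Section ToPGL.
Local Open Scope quotient_scope.
Variable R : comUnitRingType.
Implicit Types (A B P : 'M[R]_2) (h g : PGL 2 R).

(** Made total by sending singular matrices to the identity, which is why [lifts] also asks for
    invertibility. *)
Definition toPGL A : PGL 2 R := \pi_(PGL 2 R) (insubd (GL_one 2 R) A).

Definition lifts h A := A \in unitmx /\ h = toPGL A.

Lemma toPGLE A (uA : A \in unitmx) : toPGL A = \pi_(PGL 2 R) (MkGL uA).
Proof. by congr (\pi_(PGL 2 R) _); apply: val_inj; rewrite val_insubd uA. Qed.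

Lemma lifts_ex h : exists A, lifts h A.
Proof.
elim/quotW: h => -[A uA]; exists A; split=> //.
by rewrite (toPGLE uA).
Qed.

Lemma liftsZ h A c : c \is a GRing.unit -> lifts h A -> lifts h (c *: A).
Proof.
move=> uc [uA ->]; have ucA : c *: A \in unitmx by rewrite unitmxZ.
split=> //; rewrite (toPGLE uA) (toPGLE ucA); apply/eqmodP/asboolP.
by exists c^-1; rewrite ?unitrV //= scalerA mulVr // scale1r.
Qed.

Lemma liftsM h g A B : lifts h A -> lifts g B -> lifts (h * g)%g (A *m B).
Proof.
move=> [uA ->] [uB ->]; have uAB : A *m B \in unitmx by rewrite unitmx_mul uA.
split=> //; rewrite (toPGLE uA) (toPGLE uB) (toPGLE uAB).
rewrite -[LHS]/(PGL_mul _ _) !piE; congr (\pi_(PGL 2 R) _); exact: val_inj.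
Qed.

Lemma lifts1 c : c \is a GRing.unit -> lifts 1%g c%:M.
Proof.
move=> uc; rewrite -scalemx1; apply: liftsZ => //; split; first exact: unitmx1.
by rewrite (toPGLE (unitmx1 R 2)) -[LHS]/(PGL_one 2 R) !piE;
  congr (\pi_(PGL 2 R) _); exact: val_inj.
Qed.

Lemma lifts1_scalar A : lifts 1%g A -> exists c, A = c%:M.
Proof.
have [_ E] := lifts1 (unitr1 R); move=> [uA]; rewrite E (toPGLE (unitmx1 R 2)).
rewrite (toPGLE uA) => /eqmodP/asboolP[c uc /= e].
by exists c^-1; rewrite -(scalemx1 _ c^-1) [1%:M]e scalerA mulVr // scale1r.
Qed.

(** The adjugate differs from the inverse by a unit scalar only, and keeps commutators polynomial in
    the entries. *)
Lemma liftsV h A : lifts h A -> lifts h^-1%g (\adj A).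
Proof.
move=> hA; have [uA _] := hA; have uD : \det A \is a GRing.unit by rewrite -unitmxE.
have adjE : \adj A = \det A *: invmx A by rewrite /invmx uA scalerA mulrV // scale1r.
have uadj : \adj A \in unitmx by rewrite adjE unitmxZ // unitmx_inv.
suff -> : h^-1%g = toPGL (\adj A) by [].
apply: (@mulgI _ h); rewrite mulgV; have [_ ->] := liftsM hA (conj uadj erefl).
by rewrite mul_mx_adj; case: (lifts1 uD).
Qed.

Lemma liftsX h A n : lifts h A -> lifts (h ^+ n)%g (A ^+ n).
Proof.
move=> hA; elim: n => [|n IHn]; first by rewrite expg0 expr0; exact: lifts1 (unitr1 R).
by rewrite expgS exprS -mulmxE; exact: liftsM.
Qed.

Lemma liftsJ h A P : P \in unitmx -> lifts h A ->
  lifts (h ^ (toPGL P)^-1)%g (P *m A *m invmx P).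
Proof.
move=> uP hA; rewrite conjgE invgK mulgA.
have lP : lifts (toPGL P) P by [].
apply: liftsM; first exact: liftsM.
have uD : \det P \is a GRing.unit by rewrite -unitmxE.
by rewrite /invmx uP; apply: liftsZ; rewrite ?unitrV //; exact: liftsV.
Qed.

Lemma lifts_inj h g A : lifts h A -> lifts g A -> h = g.
Proof. by move=> [_ ->] [_ ->]. Qed.

End ToPGL.

(** * Conjugacy over R from traces and determinants *)

Section Conjugators.
Variable R : idomainType.
Hypothesis unit2 : (2 : R) \is a GRing.unit.
Hypothesis conj_antidiag : forall e b c : R, e ^+ 2 + b * c \is a GRing.unit ->
  exists2 P, P \in unitmx &
    P *m mx2 e b c (- e) = antidiag (e ^+ 2 + b * c) *m P.
Implicit Types A : 'M[R]_2.

(** Doubling keeps the entries of the traceless part free of halves; [conj_double] divides by 2 at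
    the end. *)
Let double_traceless A :
  {B : R * R * R | 2 *: A = (\tr A)%:M + mx2 B.1.1 B.1.2 B.2 (- B.1.1) &
    B = (A 0 0 - A 1 1, 2 * A 0 1, 2 * A 1 0)}.
Proof.
exists (A 0 0 - A 1 1, 2 * A 0 1, 2 * A 1 0) => //.
by rewrite {1 2}[A]mx2_eta !mx2E /=; congr mx2; ring.
Qed.

Let conj_double P A A' X X' : \tr A = \tr A' -> 2 *: A = (\tr A)%:M + X ->
  2 *: A' = (\tr A')%:M + X' -> P *m X = X' *m P -> P *m A = A' *m P.
Proof.
move=> tE AX AX' PX.
have : 2 *: (P *m A) = 2 *: (A' *m P).
  rewrite scalemxAr AX scalemxAl AX' mulmxDr mulmxDl PX tE.
  by rewrite mul_scalar_mx mul_mx_scalar.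
by move=> /(congr1 (fun Y => 2^-1 *: Y)); rewrite !scalerA mulVr // !scale1r.
Qed.

(** The traceless parts of [2 *: A] and [2 *: A'] are both conjugate to the [antidiag] of the common
    discriminant. *)
Lemma conj_of_trace_det A A' :
  \tr A ^+ 2 - 4 * \det A \is a GRing.unit ->
  \tr A = \tr A' -> \det A = \det A' ->
  exists2 P, P \in unitmx & P *m A = A' *m P.
Proof.
move=> uD tE dE.
have [[[e b] c] /= AX [e_ b_ c_]] := double_traceless A.
have [[[e' b'] c'] /= AX' [e_' b_' c_']] := double_traceless A'.
have DE : \tr A ^+ 2 - 4 * \det A = e ^+ 2 + b * c.
  by rewrite [A]mx2_eta !mx2E e_ b_ c_; ring.
have DE' : \tr A ^+ 2 - 4 * \det A = e' ^+ 2 + b' * c'.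
  by rewrite tE dE [A']mx2_eta !mx2E e_' b_' c_'; ring.
have [P uP PX] := conj_antidiag (e := e) (b := b) (c := c) ltac:(by rewrite -DE).
have [Q uQ QX] := conj_antidiag (e := e') (b := b') (c := c') ltac:(by rewrite -DE').
exists (invmx Q *m P); first by rewrite unitmx_mul unitmx_inv uQ.
apply: (conj_double tE AX AX').
rewrite -mulmxA PX -DE DE' -[RHS](mulKmx uQ); congr (_ *m _).
by rewrite !mulmxA QX mulmxK.
Qed.

Lemma conj_pair_of_traces A1 A2 A1' A2' :
  pair_disc A1 A2 \is a GRing.unit ->
  \tr A1 = \tr A1' -> \tr A2 = \tr A2' -> \det A1 = \det A1' ->
  \det A2 = \det A2' -> \tr (A1 *m A2) = \tr (A1' *m A2') ->
  exists2 P, P \in unitmx & P *m A1 = A1' *m P /\ P *m A2 = A2' *m P.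
Proof.
move=> uD t1 t2 d1 d2 t12.
have [[[e1 b1] c1] /= A1X [e1_ b1_ c1_]] := double_traceless A1.
have [[[e2 b2] c2] /= A2X [e2_ b2_ c2_]] := double_traceless A2.
have [[[e1' b1'] c1'] /= A1X' [e1_' b1_' c1_']] := double_traceless A1'.
have [[[e2' b2'] c2'] /= A2X' [e2_' b2_' c2_']] := double_traceless A2'.
have n1 : \tr A1 ^+ 2 - 4 * \det A1 = e1 ^+ 2 + b1 * c1.
  by rewrite [A1]mx2_eta !mx2E e1_ b1_ c1_; ring.
have n2 : \tr A2 ^+ 2 - 4 * \det A2 = e2 ^+ 2 + b2 * c2.
  by rewrite [A2]mx2_eta !mx2E e2_ b2_ c2_; ring.
have n1' : \tr A1 ^+ 2 - 4 * \det A1 = e1' ^+ 2 + b1' * c1'.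
  by rewrite t1 d1 [A1']mx2_eta !mx2E e1_' b1_' c1_'; ring.
have n2' : \tr A2 ^+ 2 - 4 * \det A2 = e2' ^+ 2 + b2' * c2'.
  by rewrite t2 d2 [A2']mx2_eta !mx2E e2_' b2_' c2_'; ring.
have m : 2 * (2 * \tr (A1 *m A2) - \tr A1 * \tr A2)
    = 2 * e1 * e2 + b1 * c2 + c1 * b2.
  by rewrite [A1]mx2_eta [A2]mx2_eta !mx2E e1_ b1_ c1_ e2_ b2_ c2_; ring.
have m' : 2 * (2 * \tr (A1 *m A2) - \tr A1 * \tr A2)
    = 2 * e1' * e2' + b1' * c2' + c1' * b2'.
  rewrite t12 t1 t2 [A1']mx2_eta [A2']mx2_eta !mx2E.
  by rewrite e1_' b1_' c1_' e2_' b2_' c2_'; ring.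
have [||||P uP [P1 P2]] := @conj_pair R unit2 conj_antidiag e1 b1 c1 e2 b2 c2
  e1' b1' c1' e2' b2' c2'.
- by rewrite -n1 n1'.
- by rewrite -n2 n2'.
- by rewrite -m m'.
- rewrite -n1 -n2 -m; set u := (X in X \is a _).
  have -> : u = 2 * 2 * pair_disc A1 A2 by rewrite /u /pair_disc; ring.
  by rewrite !unitrM unit2.
exists P => //; split; [exact: (conj_double t1 A1X A1X') | exact: (conj_double t2 A2X A2X')].
Qed.

End Conjugators.

(** * Finite subgroups over an abstract domain [R] with a subring [K] of constants *)

Section FiniteSubgroups.
Variable R : idomainType.
Hypothesis unit2 : (2 : R) \is a GRing.unit.
Hypothesis char0 : forall n, (n.+1%:R : R) != 0.
Hypothesis conj_antidiag : forall e b c : R, e ^+ 2 + b * c \is a GRing.unit ->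
  exists2 P, P \in unitmx &
    P *m mx2 e b c (- e) = antidiag (e ^+ 2 + b * c) *m P.
Variable K : {pred R}.
Hypothesis K_subring : subring_closed K.
Hypothesis K_unit : forall x, x \in K -> x != 0 -> x \is a GRing.unit.
Hypothesis K_sqrt : forall x, x ^+ 2 \in K -> x \in K.
Variables ts ds : seq R.
Hypothesis ts_K : {subset ts <= K}.
Hypothesis torsion_trace : forall A : 'M[R]_2, \det A \is a GRing.unit ->
  scalar_power A -> exists2 t, t \in ts & (\tr A) ^+ 2 = t * \det A.
Hypothesis mod_squares : forall d, d \is a GRing.unit ->
  exists2 c, c \is a GRing.unit & c ^+ 2 * d \in ds.

Implicit Types (A P : 'M[R]_2) (h g : PGL 2 R) (H : set (PGL 2 R)).

Let normalized h A := lifts h A /\ \det A \in ds.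

Lemma normalized_ex h : exists A, normalized h A.
Proof.
have [A hA] := lifts_ex h; have [uA _] := hA.
have [c uc cds] := mod_squares (d := \det A) ltac:(by rewrite -unitmxE).
by exists (c *: A); split; [exact: liftsZ | rewrite detZ].
Qed.

(** Up to three normalised lifts get multiplied, as in [A A1 A2]; the added [1] covers shorter
    products. *)
Let dets : seq R := [seq x * y | x <- 1 :: ds, y <- [seq x * y | x <- 1 :: ds, y <- 1 :: ds]].

Let traces : set R := [set r | exists t d, [/\ t \in ts, d \in dets & r ^+ 2 = t * d]].

(** Only the square of a trace is known, but a domain has at most two square roots of each value. *)
Lemma finite_traces : finite_set traces.
Proof.
apply: (@sub_finite_set _ _
  (\bigcup_(v in [set` [seq t * d | t <- ts, d <- dets]]) [set r | r ^+ 2 = v])).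
  move=> r [t [d [tt dd rE]]]; exists (t * d) => //.
  exact: allpairs_f.
apply: bigcup_finite => [|v _]; first exact: finite_seq.
have [[s sE]|no] := pselect (exists s, s ^+ 2 = v); last first.
  by rewrite (_ : [set r | _] = set0) //; apply/seteqP; split=> // r rE; apply: no; exists r.
apply: (@sub_finite_set _ _ [set s; - s]); last exact: finite_set2.
move=> r /= rE; have /eqP : r ^+ 2 = s ^+ 2 by rewrite rE.
by rewrite eqf_sqr => /orP[] /eqP; [left | right].
Qed.

Lemma mem_dets x y z : x \in 1 :: ds -> y \in 1 :: ds -> z \in 1 :: ds ->
  x * y * z \in dets.
Proof.
by move=> xd yd zd; rewrite -mulrA; do 2!apply: allpairs_f => //.
Qed.

Lemma lifts_scalar_power H h A : finite_subgroup H -> H h -> lifts h A ->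
  scalar_power A.
Proof.
move=> finH Hh hA; have [n hn] := finite_subgroup_torsion finH Hh.
by exists n; apply: lifts1_scalar; rewrite -hn; exact: liftsX.
Qed.

Lemma lifts_trace H h A : finite_subgroup H -> H h -> lifts h A ->
  exists2 t, t \in ts & \tr A ^+ 2 = t * \det A.
Proof.
move=> finH Hh hA; apply: torsion_trace; last exact: (lifts_scalar_power finH Hh hA).
by rewrite -unitmxE; case: hA.
Qed.

Lemma mem_traces H h A : finite_subgroup H -> H h -> lifts h A -> \det A \in dets ->
  traces (\tr A).
Proof.
by move=> finH Hh hA dA; have [t tt tE] := lifts_trace finH Hh hA; exists t, (\det A).
Qed.

Lemma K_op x y : x \in K -> y \in K -> [/\ x + y \in K, x - y \in K & x * y \in K].
Proof.
have [K1 KB KM] := K_subring => xK yK.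
have K0 : 0 \in K by have := KB _ _ K1 K1; rewrite subrr.
have KN : - y \in K by have := KB _ _ K0 yK; rewrite sub0r.
by split; [have := KB _ _ xK KN; rewrite opprK | exact: KB | exact: KM].
Qed.

Lemma K_nat n : n%:R \in K.
Proof.
have [K1 KB _] := K_subring; elim: n => [|n IHn].
  by have := KB _ _ K1 K1; rewrite subrr.
by rewrite mulrS; have [] := K_op K1 IHn.
Qed.

(* The discriminant is [det A1 * det A2] times an element of [K]: the product
   of the three traces is, because its square is. *)
Lemma pair_disc_unit A1 A2 t1 t2 t12 : A1 \in unitmx -> A2 \in unitmx ->
  t1 \in K -> t2 \in K -> t12 \in K ->
  \tr A1 ^+ 2 = t1 * \det A1 -> \tr A2 ^+ 2 = t2 * \det A2 ->
  \tr (A1 *m A2) ^+ 2 = t12 * \det (A1 *m A2) ->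
  pair_disc A1 A2 != 0 -> pair_disc A1 A2 \is a GRing.unit.
Proof.
rewrite !unitmxE det_mulmx => u1 u2 K1 K2 K12 E1 E2 E12 nz.
set d := \det A1 * \det A2 in E12 *; have ud : d \is a GRing.unit by rewrite unitrM u1.
pose s := \tr A1 * \tr A2 * \tr (A1 *m A2) / d.
have sd : s * d = \tr A1 * \tr A2 * \tr (A1 *m A2) by rewrite /s mulrVK.
have sK : s \in K.
  apply: K_sqrt; suff -> : s ^+ 2 = t1 * t2 * t12.
    by have [_ _ K3] := K_op K1 K2; have [_ _] := K_op K3 K12.
  by apply: (mulIr (unitrX 2 ud)); rewrite -exprMn sd !exprMn E1 E2 E12 /d; ring.
pose k := (t1 - 4) * (t2 - 4) - 4 * t12 + 4 * s - t1 * t2.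
have kE : pair_disc A1 A2 = k * d.
  rewrite /pair_disc; transitivity
   ((\tr A1 ^+ 2 - 4 * \det A1) * (\tr A2 ^+ 2 - 4 * \det A2) - 4 * \tr (A1 *m A2) ^+ 2
     + 4 * (\tr A1 * \tr A2 * \tr (A1 *m A2)) - \tr A1 ^+ 2 * \tr A2 ^+ 2); first by ring.
  by rewrite -sd E1 E2 E12 /k /d; ring.
have kK : k \in K.
  have [_ a _] := K_op K1 (K_nat 4); have [_ b _] := K_op K2 (K_nat 4).
  have [_ _ ab] := K_op a b; have [_ _ c] := K_op (K_nat 4) K12.
  have [_ _ e] := K_op (K_nat 4) sK; have [_ _ f] := K_op K1 K2.
  have [_ abc _] := K_op ab c; have [abce _ _] := K_op abc e.
  by have [_ ] := K_op abce f.
rewrite kE unitrM ud andbT; apply: K_unit => //.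
by apply: contraNneq nz => k0; rewrite kE k0 mul0r.
Qed.

(** These sets cover [H] after conjugation. By [comm_trace0] and [pair_trace0] the listed traces
    determine the lift [A], and they range over a finite set. *)
Let commuting_set A1 : set (PGL 2 R) := [set h | exists A,
  [/\ lifts h A, A *m A1 = A1 *m A, traces (\tr A) & traces (\tr (A *m A1))]].

Let pair_set A1 A2 : set (PGL 2 R) := [set h | exists A,
  [/\ lifts h A, traces (\tr A), traces (\tr (A *m A1)), traces (\tr (A *m A2)) &
      traces (\tr (A *m A1 *m A2))]].

Lemma finite_commuting_set A1 : \tr A1 ^+ 2 - 4 * \det A1 != 0 ->
  finite_set (commuting_set A1).
Proof.
move=> nzD; pose f A := (\tr A, \tr (A *m A1)).
pose S := [set A | A *m A1 = A1 *m A /\ (traces `*` traces) (f A)].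
suff finS : finite_set S.
  apply: sub_finite_set (finite_image (@toPGL R) finS).
  by move=> h [A [[uA ->] AC tA tA1]]; exists A.
have finj : {in S &, injective f}.
  move=> A A' /set_mem[AC _] /set_mem[AC' _] [tE tE1]; apply/eqP; rewrite -subr_eq0; apply/eqP.
  apply: (comm_trace0 nzD); first by rewrite mulmxBl mulmxBr AC AC'.
    by rewrite linearB /= tE subrr.
  by rewrite mulmxBl linearB /= tE1 subrr.
apply: (finite_set_inj 0 finj); apply: sub_finite_set (finite_setX finite_traces finite_traces).
by move=> _ [A [_ Af] <-].
Qed.

Lemma finite_pair_set A1 A2 : pair_disc A1 A2 != 0 -> finite_set (pair_set A1 A2).
Proof.
move=> nzD; pose f A := ((\tr A, \tr (A *m A1)), (\tr (A *m A2), \tr (A *m A1 *m A2))).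
pose V2 := traces `*` traces; pose S := [set A | (V2 `*` V2) (f A)].
suff finS : finite_set S.
  apply: sub_finite_set (finite_image (@toPGL R) finS).
  by move=> h [A [[uA ->] a b c d]]; exists A.
have finj : {in S &, injective f}.
  move=> A A' _ _ [tE tE1 tE2 tE3]; apply/eqP; rewrite -subr_eq0; apply/eqP.
  apply: (pair_trace0 nzD); rewrite ?mulmxBl linearB /=; apply/eqP;
    by rewrite subr_eq0 ?tE ?tE1 ?tE2 ?tE3.
apply: (finite_set_inj 0 finj).
have finV2 := finite_setX finite_traces finite_traces.
by apply: sub_finite_set (finite_setX finV2 finV2) => _ [A Af <-].
Qed.

Let good_mx : set 'M[R]_2 := [set A |
  [/\ \det A \in ds, traces (\tr A) & \tr A ^+ 2 - 4 * \det A \is a GRing.unit]].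

Let good_pair : set ('M[R]_2 * 'M[R]_2) := [set A |
  [/\ \det A.1 \in ds, \det A.2 \in ds, traces (\tr A.1), traces (\tr A.2) &
      traces (\tr (A.1 *m A.2)) /\ pair_disc A.1 A.2 \is a GRing.unit]].

(** The invariants take finitely many values; one reference matrix per value keeps the covering
    family finite. *)
Lemma good_mx_classes : exists S, [/\ finite_set S, S `<=` good_mx &
  forall A, good_mx A -> exists2 A', S A' &
    exists2 P, P \in unitmx & P *m A = A' *m P].
Proof.
pose f A := (\det A, \tr A).
have [|S [finS SG GS]] := @finite_section _ _ 0 good_mx f.
  apply: sub_finite_set (finite_setX (finite_seq ds) finite_traces).
  by move=> _ [A [Ad At _] <-].
exists S; split=> // A GA; have [A' SA' [dE tE]] := GS A GA.
by exists A' => //; apply: conj_of_trace_det => //; case: GA.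
Qed.

Lemma good_pair_classes : exists S, [/\ finite_set S, S `<=` good_pair &
  forall A : 'M[R]_2 * 'M[R]_2, good_pair A -> exists2 A', S A' &
    exists2 P, P \in unitmx & P *m A.1 = A'.1 *m P /\ P *m A.2 = A'.2 *m P].
Proof.
pose f (A : 'M[R]_2 * 'M[R]_2) :=
  ((\det A.1, \tr A.1), ((\det A.2, \tr A.2), \tr (A.1 *m A.2))).
have [|S [finS SG GS]] := @finite_section _ _ (0, 0) good_pair f.
  have fin1 := finite_setX (finite_seq ds) finite_traces.
  apply: sub_finite_set (finite_setX fin1 (finite_setX fin1 finite_traces)).
  by move=> _ [A [d1 d2 t1 t2 [t12 _]] <-].
exists S; split=> // A GA; have [A' SA' [d1 t1 d2 t2 t12]] := GS A GA.
by exists A' => //; apply: conj_pair_of_traces => //; case: GA => _ _ _ _ [].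
Qed.

Theorem property_FC_PGL2 : property_FC (PGL 2 R).
Proof.
have [S1 [finS1 S1G GS1]] := good_mx_classes.
have [S2 [finS2 S2G GS2]] := good_pair_classes.
pose FF := [set [set 1%g]] `|` ((commuting_set @` S1) `|`
  ((fun A : 'M[R]_2 * 'M[R]_2 => pair_set A.1 A.2) @` S2)).
have nz_unit (x : R) : x \is a GRing.unit -> x != 0.
  by apply: contraTneq => ->; rewrite unitr0.
apply: (@property_FC_of_cover _ FF).
- by rewrite !finite_setU; split; [exact: finite_set1 | split; exact: finite_image].
- move=> F [->|[[A SA <-]|[A SA <-]]]; first exact: finite_set1.
    by apply: finite_commuting_set; apply: nz_unit; case: (S1G _ SA).
  by apply: finite_pair_set; apply: nz_unit; case: (S2G _ SA) => _ _ _ _ [].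
move=> H finH; have [_ Hg] := finH.
have HM h g : H h -> H g -> H (h * g)%g.
  by move=> /mem_set Hh /mem_set Hg'; apply: set_mem; exact: group_closedM.
have HV h : H h -> H h^-1%g.
  by move=> /mem_set Hh; apply: set_mem; exact: group_closedV.
have in1 x : x \in ds -> x \in 1 :: ds by rewrite inE orbC => ->.
have one1 : 1 \in 1 :: ds by rewrite inE eqxx.
have dets1 x : x \in ds -> x \in dets.
  by move=> xd; have := mem_dets (in1 _ xd) one1 one1; rewrite !mulr1.
have dets2 x y : x \in ds -> y \in ds -> x * y \in dets.
  by move=> xd yd; have := mem_dets (in1 _ xd) (in1 _ yd) one1; rewrite !mulr1.
have dets3 x y z : x \in ds -> y \in ds -> z \in ds -> x * y * z \in dets.
  by move=> /in1 xd /in1 yd /in1 zd; exact: mem_dets.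
have cjM P X Y : P \in unitmx -> (P *m X *m invmx P) *m (P *m Y *m invmx P)
    = P *m (X *m Y) *m invmx P.
  by move=> uP; rewrite !mulmxA mulmxKV.
have trcj P X : P \in unitmx -> \tr (P *m X *m invmx P) = \tr X.
  by move=> uP; rewrite mxtrace_mulC mulmxA mulVmx // mul1mx.
have cjE P X Y : P \in unitmx -> P *m X = Y *m P -> Y = P *m X *m invmx P.
  by move=> uP ->; rewrite mulmxK.
(* Without such a pair, [pair_disc0_comm] makes all normalised lifts commute. *)
have [[h1 [h2 [A1 [A2 [Hh1 Hh2 n1 n2 nzD]]]]]|no] := pselect (exists h1 h2 A1 A2,
  [/\ H h1, H h2, normalized h1 A1, normalized h2 A2 & pair_disc A1 A2 != 0]).
  have [[l1 d1] [l2 d2]] := (n1, n2).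
  have l12 := liftsM l1 l2.
  have G12 : good_pair (A1, A2).
    split=> //=; [exact: (mem_traces finH Hh1 l1 (dets1 _ d1)) |
      exact: (mem_traces finH Hh2 l2 (dets1 _ d2)) | split].
      by apply: (mem_traces finH (HM _ _ Hh1 Hh2) l12); rewrite det_mulmx; exact: dets2.
    have [t1 K1 E1] := lifts_trace finH Hh1 l1.
    have [t2 K2 E2] := lifts_trace finH Hh2 l2.
    have [t12 K12 E12] := lifts_trace finH (HM _ _ Hh1 Hh2) l12.
    by apply: pair_disc_unit (ts_K K1) (ts_K K2) (ts_K K12) E1 E2 E12 nzD;
      [case: l1 | case: l2].
  have [[A1' A2'] SA [P uP [/= P1 P2]]] := GS2 _ G12.
  (* The inverse appears because [h ^ g] is [g^-1 h g], while [P] conjugates as [P A P^-1]. *)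
  exists (toPGL P)^-1%g, (pair_set A1' A2').
    by right; right; exists (A1', A2').
  move=> h Hh; have [A [lA dA]] := normalized_ex h.
  exists (P *m A *m invmx P).
  rewrite (cjE _ _ _ uP P1) (cjE _ _ _ uP P2) !cjM // !trcj //.
  split; first exact: liftsJ.
  - exact: (mem_traces finH Hh lA (dets1 _ dA)).
  - by apply: (mem_traces finH (HM _ _ Hh Hh1) (liftsM lA l1)); rewrite det_mulmx; exact: dets2.
  - by apply: (mem_traces finH (HM _ _ Hh Hh2) (liftsM lA l2)); rewrite det_mulmx; exact: dets2.
  apply: (mem_traces finH (HM _ _ (HM _ _ Hh Hh1) Hh2) (liftsM (liftsM lA l1) l2)).
  by rewrite !det_mulmx; exact: dets3.
have comm h1 h2 A1 A2 : H h1 -> H h2 -> normalized h1 A1 -> normalized h2 A2 ->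
    A1 *m A2 = A2 *m A1.
  move=> H1 H2 n1 n2; have [[l1 _] [l2 _]] := (n1, n2).
  apply: (pair_disc0_comm char0).
  - by rewrite -unitmxE; case: l1.
  - by rewrite -unitmxE; case: l2.
  - apply: (lifts_scalar_power finH (h := h1 * h2 * h1^-1 * h2^-1)%g).
      by exact: (HM _ _ (HM _ _ (HM _ _ H1 H2) (HV _ H1)) (HV _ H2)).
    by apply: liftsM; [apply: liftsM; [exact: liftsM | exact: liftsV] | exact: liftsV].
  by apply/eqP/negPn/negP => nzD; apply: no; exists h1, h2, A1, A2.
have [[h1 Hh1 /eqP nh1]|triv] := pselect (exists2 h1, H h1 & h1 != 1%g); last first.
  exists 1%g, [set 1%g]; first by left.
  move=> h Hh /=; rewrite conjg1; apply: contrapT => /eqP nh; apply: triv.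
  by exists h.
have [A1 n1] := normalized_ex h1; have [l1 d1] := n1; have [u1 _] := l1.
have G1 : good_mx A1.
  split=> //; first exact: (mem_traces finH Hh1 l1 (dets1 _ d1)).
  have [t tt E] := lifts_trace finH Hh1 l1.
  have u1' : \det A1 \is a GRing.unit by rewrite -unitmxE.
  rewrite E -mulrBl unitrM u1' andbT; apply: K_unit.
    by have [_ ? _] := K_op (ts_K tt) (K_nat 4).
  (* The value 4 means discriminant zero; then the torsion lift [A1] is scalar and [h1] trivial. *)
  apply/eqP => /eqP; rewrite subr_eq0 => /eqP t4; apply: nh1.
  have [a A1a] := torsion_disc0 char0 u1' (lifts_scalar_power finH Hh1 l1)
    (etrans E (congr1 (fun x => x * _) t4)).
  apply: (lifts_inj l1); rewrite A1a; apply: lifts1.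
  by move: u1'; rewrite A1a det_scalar; rewrite unitrX_pos.
have [A1' SA [P uP P1]] := GS1 _ G1.
exists (toPGL P)^-1%g, (commuting_set A1').
  by right; left; exists A1'.
move=> h Hh; have [A nA] := normalized_ex h; have [lA dA] := nA.
exists (P *m A *m invmx P).
rewrite (cjE _ _ _ uP P1) !cjM // !trcj // (comm _ _ _ _ Hh Hh1 nA n1).
split=> //; first exact: liftsJ.
- exact: (mem_traces finH Hh lA (dets1 _ dA)).
rewrite -(comm _ _ _ _ Hh Hh1 nA n1).
by apply: (mem_traces finH (HM _ _ Hh Hh1) (liftsM lA l1)); rewrite det_mulmx; exact: dets2.
Qed.

End FiniteSubgroups.

(** * Laurent polynomials *)

Section UnitDiscriminant.
Variable R : comUnitRingType.
Hypothesis unit2 : (2 : R) \is a GRing.unit.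
Implicit Types e b c p q s : R.

(* [det (u, A u)] for [u = (p, q)] and [A = mx2 e b c (- e)]. *)
Definition cyclic_form e b c p q := c * p ^+ 2 - 2 * e * p * q - b * q ^+ 2.

Definition represents_unit e b c :=
  exists p q, cyclic_form e b c p q \is a GRing.unit.

(** If [det (u, A u)] is a unit, then [u, A u] is a basis, and since [A^2] is the scalar [e^2 + b c]
    the matrix of [A] in it is [antidiag]. The columns of [Q] are [u] and [A u]. *)
Lemma represents_unit_conj e b c : represents_unit e b c ->
  exists2 P, P \in unitmx &
    P *m mx2 e b c (- e) = antidiag (e ^+ 2 + b * c) *m P.
Proof.
move=> [p [q upq]]; pose Q := mx2 p (e * p + b * q) q (c * p - e * q).
have uQ : Q \in unitmx.
  rewrite /Q mx2_unit; set u := (X in X \is a _).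
  by have -> : u = cyclic_form e b c p q by rewrite /u /cyclic_form; ring.
exists (invmx Q); first by rewrite unitmx_inv.
have AQ : mx2 e b c (- e) *m Q = Q *m antidiag (e ^+ 2 + b * c).
  by rewrite /Q /antidiag !mx2M; congr mx2; ring.
rewrite -[LHS](mulmxK uQ) -(mulmxA (invmx Q)) AQ mulmxA mulVmx // mul1mx.
by [].
Qed.

Lemma represents_unit_swap e b c :
  represents_unit (- e) c b -> represents_unit e b c.
Proof.
move=> [p [q u]]; exists q, p; rewrite -unitrN.
by have -> : - cyclic_form e b c q p = cyclic_form (- e) c b p q
  by rewrite /cyclic_form; ring.
Qed.

Lemma represents_unit_shear s e b c :
  represents_unit (e + s * c) (b - 2 * s * e - s ^+ 2 * c) c ->
  represents_unit e b c.
Proof.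
move=> [p [q u]]; exists (p - s * q), q.
by have -> : cyclic_form e b c (p - s * q) q =
  cyclic_form (e + s * c) (b - 2 * s * e - s ^+ 2 * c) c p q
  by rewrite /cyclic_form; ring.
Qed.

Lemma represents_unit_c e b c : c \is a GRing.unit -> represents_unit e b c.
Proof.
by move=> uc; exists 1, 0; rewrite /cyclic_form mulr0 expr0n mulr0 !subr0 expr1n mulr1.
Qed.

Lemma represents_unit_b0 e c : e \is a GRing.unit -> represents_unit e 0 c.
Proof.
move=> ue; have u2e : 2 * e \is a GRing.unit by rewrite unitrM unit2.
(* With [b = 0] the form at [(1, q)] is [c - 2 e q]; this [q] makes it equal to 1. *)
exists 1, ((c - 1) / (2 * e)); rewrite /cyclic_form.
by rewrite mul0r subr0 expr1n !mulr1 mulrC divrK // subKr unitr1.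
Qed.

End UnitDiscriminant.

(** * Chebyshev polynomials and powers of 2x2 matrices of determinant 1 *)

Section Chebyshev.

(** Chebyshev polynomials of the second kind, rescaled and shifted: for [t = z + z^-1] the value is
    [(z^n - z^-n) / (z - z^-1)]. *)
Fixpoint chebU (S : nzRingType) (t : S) n : S :=
  if n is n'.+1 then if n' is n''.+1 then t * chebU t n' - chebU t n'' else 1 else 0.

Lemma chebUSS (S : nzRingType) (t : S) n :
  chebU t n.+2 = t * chebU t n.+1 - chebU t n.
Proof. by []. Qed.

Lemma nat_ind2 (T : nat -> Prop) : T 0%N -> T 1%N ->
  (forall n, T n -> T n.+1 -> T n.+2) -> forall n, T n.
Proof.
move=> T0 T1 TS n; suff : T n /\ T n.+1 by case.
by elim: n => [|n [Tn TSn]]; split=> //; exact: TS.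
Qed.

Lemma rmorph_chebU (S S' : nzRingType) (f : {rmorphism S -> S'}) t n :
  f (chebU t n) = chebU (f t) n.
Proof.
elim/nat_ind2: n => [||n IH0 IH1]; rewrite ?rmorph0 ?rmorph1 //.
by rewrite !chebUSS rmorphB rmorphM IH0 IH1.
Qed.

(** Monicity makes the zeros integral over the constants, and finite in number over a field. *)
Lemma chebUX_monic (S : idomainType) n :
  chebU ('X : {poly S}) n.+1 \is monic /\ size (chebU ('X : {poly S}) n.+1) = n.+1.
Proof.
elim/nat_ind2: n => [||n [_ s0] [m1 s1]].
- by rewrite monic1 size_poly1.
- by rewrite chebUSS /= mulr1 subr0 monicX size_polyX.
have sX : size ('X * chebU 'X n.+2 : {poly S}) = n.+3.
  by rewrite mulrC size_mulX ?s1 // -size_poly_eq0 s1.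
have slt : (size (- chebU ('X : {poly S}) n.+1)%R < size ('X * chebU 'X n.+2 : {poly S})%R)%N.
  by rewrite sX size_polyN s0.
rewrite chebUSS; split; last by rewrite size_polyDl.
by rewrite monicE lead_coefDl // mulrC lead_coefMX -monicE.
Qed.

(** The hypothesis is Cayley-Hamilton for determinant 1. Consequently, over a domain, a non-scalar
    [M] with [M ^+ n.+1 = 1] forces [chebU t n.+1 = 0]. *)
Lemma sl2_expr (S : comNzRingType) (M : 'M[S]_2) t n : M ^+ 2 = t *: M - 1 ->
  M ^+ n.+1 = chebU t n.+1 *: M - (chebU t n)%:M.
Proof.
move=> M2; elim: n => [|n IHn].
  by rewrite expr1 scale1r /= raddf0 subr0.
rewrite exprS IHn -mulmxE mulmxBr -scalemxAr mul_mx_scalar mulmxE -expr2 M2.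
rewrite chebUSS scalerBr scalerA [t * _]mulrC scalerBl addrAC.
by rewrite -[1]/(1%:M) scalemx1.
Qed.

End Chebyshev.

(** * Polynomials inside the concrete Laurent ring *)

Section LaurentRing.
Variable k : fieldType.
Local Notation R := (laurent k).
Implicit Types (f : R) (q r : {poly k}).

Lemma lpoly_subproof q : tofrac q \in @is_laurent k.
Proof. by apply/asboolP; exists q, 0%N; rewrite expr0 tofrac1 divr1. Qed.

Definition lpoly q : R := Laurent (lpoly_subproof q).

Lemma lpoly_is_zmod_morphism : zmod_morphism lpoly.
Proof. by move=> q r; apply: val_inj; rewrite rmorphB /= tofracB. Qed.

Lemma lpoly_is_monoid_morphism : monoid_morphism lpoly.
Proof.
by split=> [|q r]; apply: val_inj; rewrite ?rmorph1 ?rmorphM /= ?tofrac1 ?tofracM.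
Qed.

HB.instance Definition _ := GRing.isZmodMorphism.Build _ _ lpoly lpoly_is_zmod_morphism.
HB.instance Definition _ := GRing.isMonoidMorphism.Build _ _ lpoly lpoly_is_monoid_morphism.

Lemma lpoly_inj : injective lpoly.
Proof. by move=> q r /(congr1 val) /= /eqP; rewrite tofrac_eq => /eqP. Qed.

Lemma laurent_numer f : exists q n, f * lpoly 'X ^+ n = lpoly q.
Proof.
have /asboolP[q [n fE]] := valP f; exists q, n; apply: val_inj.
by rewrite rmorphM rmorphXn /= fE -tofracXn divfK // tofracXn_neq0.
Qed.

Lemma unit_lpolyX : lpoly 'X \is a GRing.unit.
Proof.
have xV : (tofrac 'X)^-1 \in @is_laurent k.
  by apply/asboolP; exists 1, 1%N; rewrite tofrac1 mul1r expr1.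
apply/unitrP; exists (Laurent xV).
have X0 : tofrac 'X != 0 :> {fraction {poly k}} by rewrite -['X]expr1 tofracXn_neq0.
by split; apply: val_inj; rewrite rmorphM rmorph1 /= ?mulVf ?divff.
Qed.

End LaurentRing.

(* Abstracting from the concrete fractions keeps conversion checks from
   unfolding them, which does not terminate in practice. *)
Section LaurentArithmetic.
Variables (k : fieldType) (R : idomainType) (lpoly : {rmorphism {poly k} -> R}).
Hypothesis lpoly_inj : injective lpoly.
Local Notation x := (lpoly 'X).
Local Notation C a := (lpoly a%:P).
Hypothesis laurent_numer : forall f : R, exists q n, f * x ^+ n = lpoly q.
Hypothesis unit_x : x \is a GRing.unit.
Implicit Types (f g e b c : R) (q r : {poly k}) (z w : int).

Lemma lpoly_eq0 q : (lpoly q == 0) = (q == 0).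
Proof. by rewrite -(rmorph0 lpoly) (inj_eq lpoly_inj). Qed.

Lemma unit_xz z : x ^ z \is a GRing.unit.
Proof. exact/unitrXz/unit_x. Qed.

Lemma unit_C a : a != 0 -> C a \is a GRing.unit.
Proof.
move=> a0; apply/unitrP; exists (C a^-1).
by rewrite -!rmorphM mulVf // mulfV // !rmorph1.
Qed.

Lemma poly_split q : q != 0 -> exists n r, r`_0 != 0 /\ q = 'X^n * r.
Proof.
have [m] := ubnP (size q); elim: m q => // m IHm q sq q0.
have [q00|] := eqVneq q`_0 0; last by exists 0%N, q; rewrite expr0 mul1r.
have /factor_theorem[r qE] : root q 0 by rewrite /root horner_coef0 q00.
rewrite subr0 in qE; have r0 : r != 0 by apply: contraNneq q0 => r0; rewrite qE r0 mul0r.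
have [|n [s [s0 rE]]] := IHm r _ r0; first by rewrite qE size_mulX in sq.
by exists n.+1, s; split; rewrite // qE rE exprS; ring.
Qed.

(** [size q] is the width of [f], the number of exponents that it spans; it serves as the Euclidean
    norm in Gauss reduction. *)
Lemma laurent_form f : f != 0 -> exists z q, q`_0 != 0 /\ f = x ^ z * lpoly q.
Proof.
move=> f0; have [q [n fE]] := laurent_numer f.
have q0 : q != 0.
  rewrite -lpoly_eq0 -fE mulf_neq0 // expf_neq0 //.
  by apply: contraTneq unit_x => ->; rewrite unitr0.
have [m [r [r0 qE]]] := poly_split q0; exists (m%:Z - n%:Z), r; split=> //.
apply: (mulIr (unitrX n unit_x)); rewrite fE qE rmorphM rmorphXn /=.
have -> : x ^ (m%:Z - n%:Z) = x ^+ m / x ^+ n.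
  by rewrite (exprzDr unit_x) -exprnP -exprnN.
by rewrite mulrAC divrK // unitrX.
Qed.

Lemma lpoly_form_le z q r : q`_0 != 0 -> x ^ z * lpoly q = lpoly r ->
  exists2 n : nat, z = n & r = 'X^n * q.
Proof.
move=> q0; case: (intP z) => [|n|n].
- by rewrite expr0z mul1r => /lpoly_inj ->; exists 0%N; rewrite ?expr0 ?mul1r.
- rewrite -exprnP -rmorphXn -rmorphM => /lpoly_inj <-; by exists n.+1.
move/(congr1 (fun g => x ^+ n.+1 * g)); rewrite mulrA -exprnN mulrV ?unitrX ?unit_x //.
rewrite mul1r -rmorphXn -rmorphM => /lpoly_inj qE; move: q0.
by rewrite qE coefXnM /= eqxx.
Qed.

(** Degrees of the normalised polynomials add under products, so a unit and its inverse both have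
    width 1. *)
Lemma laurent_unitE f : f \is a GRing.unit -> exists z a, a != 0 /\ f = x ^ z * C a.
Proof.
move=> uf; have f0 : f != 0 by apply: contraTneq uf => ->; rewrite unitr0.
have fV0 : f^-1 != 0.
  by apply: contraTneq uf => fV; rewrite -unitrV fV unitr0.
have [z [q [q0 fE]]] := laurent_form f0; have [w [r [r0 gE]]] := laurent_form fV0.
have [||n _ /(congr1 (fun p => size (p : {poly k})))] := @lpoly_form_le (z + w) (q * r) 1.
- by rewrite coef0M mulf_neq0.
- by rewrite (exprzDr unit_x) rmorphM mulrACA -fE -gE mulrV // rmorph1.
have nz (p : {poly k}) : p`_0 != 0 -> p != 0 by apply: contraNneq => ->; rewrite coef0.
rewrite size_poly1 size_monicM ?monicXn ?mulf_neq0 ?nz // size_polyXn /=.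
rewrite size_mul ?nz // => sz.
have s1 : (size q <= 1)%N.
  move: (nz _ q0) (nz _ r0) sz; rewrite -!size_poly_gt0.
  by move: (size q) (size r) => sq sr; lia.
exists z, q`_0; split=> //; rewrite fE; congr (_ * lpoly _).
exact: size1_polyC.
Qed.

Definition constants : {pred R} := fun f => `[< exists a, f = C a >].

Lemma constantsP f : reflect (exists a, f = C a) (f \in constants).
Proof. exact: asboolP. Qed.

Lemma constants_subring : subring_closed constants.
Proof.
split; first by apply/constantsP; exists 1; rewrite polyC1 rmorph1.
  move=> _ _ /constantsP[a ->] /constantsP[b ->]; apply/constantsP; exists (a - b).
  by rewrite polyCB rmorphB.
move=> _ _ /constantsP[a ->] /constantsP[b ->]; apply/constantsP; exists (a * b).
by rewrite polyCM rmorphM.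
Qed.

Lemma constants_unit f : f \in constants -> f != 0 -> f \is a GRing.unit.
Proof.
move=> /constantsP[a ->] Ca; apply: unit_C; apply: contraNneq Ca => ->.
by rewrite polyC0 rmorph0.
Qed.

(** A non-zero exponent cannot cancel in [p(f)]. If [f] is a polynomial, compare degrees in the
    composite; if it has a pole at 0, the most polar term comes only from the leading power of
    [f]. *)
Lemma constants_integral f (p : {poly k}) : p \is monic ->
  (map_poly (lpoly \o polyC) p).[f] = 0 -> f \in constants.
Proof.
move=> mp pf; apply/constantsP; have [->|f0] := eqVneq f 0.
  by exists 0; rewrite polyC0 rmorph0.
have [z [q [q0 fE]]] := laurent_form f0.
have [[n zn]|[n zn]] : (exists n : nat, z = n) \/ (exists n : nat, z = - n.+1%:Z).
  by case: (intP z) => [|n|n]; [left; exists 0%N | left; exists n.+1 | right; exists n].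
  have fE' : f = lpoly ('X^n * q) by rewrite fE zn rmorphM rmorphXn.
  have : p \Po ('X^n * q) = 0.
    apply: lpoly_inj; rewrite rmorph0 -pf fE' /comp_poly map_poly_comp.
    by rewrite horner_map.
  move=> p0; have := size_comp_poly p ('X^n * q); rewrite p0 size_poly0 /=.
  move=> /eqP; rewrite eq_sym muln_eq0 => /orP[sp|sq].
    have p1 : p = 1.
      have /size1_polyC pE : (size p <= 1)%N by move: sp; case: (size p) => // -[].
      by move: mp; rewrite monicE pE lead_coefC => /eqP ->; rewrite polyC1.
    by move/eqP: pf; rewrite p1 rmorph1 hornerC oner_eq0.
  exists ('X^n * q)`_0; rewrite fE'; congr (lpoly _); apply: size1_polyC.
  by move: sq; case: (size _) => // -[].
have fxq : f * x ^+ n.+1 = lpoly q.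
  by rewrite fE zn mulrAC -exprnN mulVr ?unitrX ?unit_x // mul1r.
pose N := (size p).-1; have sp : size p = N.+1.
  by rewrite prednK // size_poly_gt0 monic_neq0.
(* [S] is [p(f)] multiplied by [x ^+ (n.+1 * N)]; at 0 only its top term survives. *)
pose S := \sum_(i < N.+1) (p`_i)%:P * q ^+ i * ('X ^+ n.+1) ^+ (N - i).
suff S0 : S = 0.
  have : S.[0] = q`_0 ^+ N.
    rewrite /S horner_sum big_ord_recr /= big1 ?add0r.
      rewrite subnn expr0 mulr1 hornerM hornerC horner_exp horner_coef0.
      by have := monicP mp; rewrite /lead_coef -/N => ->; rewrite mul1r.
    move=> i _; rewrite -exprM hornerM !horner_exp hornerX.
    by rewrite [0 ^+ _]expr0n muln_eq0 /= subn_eq0 leqNgt ltn_ord mulr0.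
  by rewrite S0 horner0 => /eqP; rewrite eq_sym expf_eq0 (negbTE q0) andbF.
apply: lpoly_inj; rewrite rmorph0 -(mul0r ((x ^+ n.+1) ^+ N)) -pf horner_coef.
rewrite size_map_poly_id0 ?sp; last first.
  by rewrite (monicP mp) /= polyC1 rmorph1 oner_neq0.
rewrite mulr_suml rmorph_sum; apply: eq_bigr => i _.
rewrite coef_map_id0 /=; last by rewrite polyC0 rmorph0.
rewrite !rmorphM !rmorphXn /= -fxq exprMn -!mulrA -exprD; congr (_ * (_ * _ ^+ _)).
by rewrite subnKC // -ltnS.
Qed.

Lemma constants_sqrt f : f ^+ 2 \in constants -> f \in constants.
Proof.
move=> /constantsP[a fa]; apply: (@constants_integral f ('X^2 - a%:P)).
  by rewrite -[2%N]/(1.+1) monicXnsubC.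
by rewrite rmorphB /= map_polyXn map_polyC !hornerE /= fa subrr.
Qed.

(* The remainder can be moved to any window of exponents because [x] is a unit
   modulo [q]. *)
Lemma window_division q z w e : q`_0 != 0 -> exists g r,
  (size r < size q)%N /\ e = g * (x ^ w * lpoly q) + x ^ z * lpoly r.
Proof.
move=> q0; have [p [n eE]] := laurent_numer (e * x ^ (- z)).
have /Bezout_eq1_coprimepP[[a d] /= ad] : coprimep ('X ^+ n) q.
  apply: coprimep_expl; rewrite coprimep_sym -['X]subr0 -polyC0 coprimep_XsubC.
  by rewrite /root horner_coef0.
have nzq : q != 0 by apply: contraNneq q0 => ->; rewrite coef0.
pose r := (p * a) %% q; exists (x ^ z / x ^ w * (lpoly ((p * a) %/ q) + lpoly (p * d) / x ^+ n)), r.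
split; first by rewrite ltn_modp.
have uX : x ^+ n \is a GRing.unit by rewrite unitrX.
have -> : e = x ^ z * (lpoly p / x ^+ n).
  by rewrite -eE mulrK // mulrC -mulrA -(exprzDr unit_x) addNr expr0z mulr1.
have pE : lpoly p = (lpoly ((p * a) %/ q) * lpoly q + lpoly r) * x ^+ n
    + lpoly (p * d) * lpoly q.
  rewrite -!rmorphM -rmorphD -divp_eq -rmorphXn -!rmorphM -rmorphD; congr (lpoly _).
  by rewrite -[p in LHS]mulr1 -ad; ring.
rewrite {1}pE mulrDl mulrK //.
have -> : x ^ z / x ^ w * (lpoly (p * a %/ q) + lpoly (p * d) / x ^+ n) * (x ^ w * lpoly q)
  = x ^ z * ((lpoly (p * a %/ q) + lpoly (p * d) / x ^+ n) * lpoly q) * (x ^ w / x ^ w).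
  by ring.
by rewrite divrr ?unit_xz //; ring.
Qed.

Lemma laurent_mod_squares (dk : seq k) :
  (forall a, a != 0 -> exists2 c, c != 0 & c ^+ 2 * a \in dk) ->
  exists ds : seq R, forall d, d \is a GRing.unit ->
    exists2 u, u \is a GRing.unit & u ^+ 2 * d \in ds.
Proof.
move=> dkP; exists [seq C a * x ^+ i | a <- dk, i <- [:: 0%N; 1%N]] => d ud.
have [j [a [a0 ->]]] := laurent_unitE ud; have [c c0 cdk] := dkP a a0.
exists (C c * x ^ (- (j %/ 2)%Z)); first by rewrite unitrM unit_C // unit_xz.
have [i [jE i2]] : exists i : nat, j = 2 * (j %/ 2)%Z + i%:Z /\ (i \in [:: 0%N; 1%N]).
  exists `|(j %% 2)%Z|%N; have := divz_eq j 2; have := modz_ge0 j (d := 2).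
  have := ltz_pmod j (d := 2); rewrite !inE; lia.
set s := (j %/ 2)%Z in jE *.
have -> : (C c * x ^ (- s)) ^+ 2 * (x ^ j * C a) = C (c ^+ 2 * a) * x ^+ i.
  rewrite jE (exprzDr unit_x) -exprnP exprMn.
  have -> : (x ^ (- s)) ^+ 2 = x ^ (- (2 * s)) by rewrite exprnP exprz_exp; congr (x ^ _); ring.
  transitivity (C c ^+ 2 * C a * x ^+ i * (x ^ (- (2 * s)) * x ^ (2 * s))); first by ring.
  by rewrite -(exprzDr unit_x) addNr expr0z mulr1 -rmorphXn -!rmorphM -polyC_exp -polyCM.
exact: allpairs_f.
Qed.

(** The matrix [M = A^2 / det A] has determinant 1 and trace [t = (tr A)^2 / det A - 2], and it is
    torsion because [A ^+ n.+1 = c] implies [c^2 = (det A) ^+ n.+1]. Either [t] is a zero of a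
    Chebyshev polynomial, or [M] is 1 or -1, which yields the values 4 and 0. *)
Lemma laurent_torsion_trace (tk : seq k) :
  (forall t n, chebU t n.+1 = 0 -> t \in tk) ->
  exists2 ts : seq R, {subset ts <= constants} &
   forall A : 'M[R]_2, \det A \is a GRing.unit -> scalar_power A ->
     exists2 t, t \in ts & (\tr A) ^+ 2 = t * \det A.
Proof.
move=> tkP; exists [:: 0, 4 & [seq C (a + 2) | a <- tk]].
  move=> t tin; apply/constantsP; move: tin; rewrite !inE.
  move=> /or3P[/eqP ->|/eqP ->|/mapP[a _ ->]].
  - by exists 0; rewrite polyC0 rmorph0.
  - by exists 4; rewrite polyC_natr rmorph_nat.
  by exists (a + 2).
move=> A uA [n [c Ac]]; set d := \det A in uA *.
pose t := \tr A ^+ 2 / d - 2.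
have tE : \tr A ^+ 2 = (t + 2) * d by rewrite subrK divrK.
suff tin : t + 2 \in [:: 0, 4 & [seq C (a + 2) | a <- tk]] by exists (t + 2).
have trA2 : \tr (A ^+ 2) = t * d.
  have -> : t * d = \tr A ^+ 2 - 2 * d by rewrite tE; ring.
  rewrite /d expr2 -mulmxE; elim/mx2_ind: A {uA Ac d t tE} => a b e f.
  by rewrite !mx2E; ring.
have A4 : A ^+ 2 *m A ^+ 2 = (t * d) *: A ^+ 2 - (d ^+ 2)%:M.
  rewrite -trA2 /d expr2 -mulmxE; elim/mx2_ind: A {uA Ac d t tE trA2} => a b e f.
  by rewrite !mx2E; congr mx2; ring.
pose M := d^-1 *: A ^+ 2.
have trM : \tr M = t by rewrite mxtraceZ trA2 mulrC mulrK.
have M2 : M ^+ 2 = t *: M - 1.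
  rewrite expr2 -mulmxE /M -scalemxAl -scalemxAr A4 !scalerBr !scalerA; congr (_ - _).
    congr (_ *: _); transitivity (d^-1 * d * (t * d^-1)); first by ring.
    by rewrite mulVr // mul1r.
  rewrite -scalemx1 scalerA -expr2 -exprMn mulVr // expr1n scale1r.
  by [].
have Mn : M ^+ n.+1 = 1.
  have cd : d ^+ n.+1 = c ^+ 2.
    have := congr1 (fun X => \det X) Ac; rewrite det_scalar => <-.
    by elim: n {Ac} => [//|n IHn]; rewrite exprS IHn -det_mulmx.
  rewrite exprZn -exprM mulnC exprM Ac expr2 -mulmxE -scalar_mxM -expr2 -cd.
  by rewrite -scalemx1 scalerA -exprMn mulVr // expr1n scale1r.
have := sl2_expr n M2; rewrite Mn => /esym UM.
have [U0|nzU] := eqVneq (chebU t n.+1) 0.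
  have /constantsP[a ta] : t \in constants.
    apply: (@constants_integral _ (chebU 'X n.+1)); first by case: (chebUX_monic k n).
    rewrite (rmorph_chebU (map_poly (lpoly \o polyC))) [X in chebU X _](map_polyX _).
    by rewrite -[LHS]/(horner_eval t _) (rmorph_chebU (horner_eval t)) [X in chebU X _](hornerX _).
  rewrite !inE; apply/orP; right; apply/orP; right; apply/mapP; exists a.
    apply: (tkP a n); apply: (@polyC_inj k); apply: lpoly_inj.
    by rewrite polyC0 rmorph0 -[LHS]/((lpoly \o polyC) _) (rmorph_chebU (lpoly \o polyC)) /= -ta.
  by rewrite ta polyCD rmorphD polyC_natr rmorph_nat.
have [m Mm] : exists m, M = m%:M.
  elim/mx2_ind: (M) UM {trM M2 Mn} => a b e f.
  rewrite -[1]/(1%:M) !mx2E => /mx2_inj[e00 e01 e10 e11].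
  have eq0 u : chebU t n.+1 * u = 0 -> u = 0.
    by move/eqP; rewrite mulf_eq0 (negbTE nzU) => /eqP.
  exists a; rewrite mx2_scalar; congr mx2; [apply: eq0 | apply: eq0 | apply: (mulfI nzU)].
  - by move: e01; rewrite oppr0 addr0.
  - by move: e10; rewrite oppr0 addr0.
  by apply: (addIr (- chebU t n)); rewrite e11 e00.
have t2m : t = 2 * m by rewrite -trM Mm mx2_scalar mx2_tr; ring.
have m1 : (m - 1) * (m + 1) = 0.
  have : M ^+ 2 = t *: M - 1 := M2.
  rewrite Mm expr2 -mulmxE -[1]/(1%:M) !mx2E => /mx2_inj[h _ _ _].
  rewrite t2m in h; transitivity (2 * m * m - 1 - (m * m + 0 * 0)); first by ring.
  by rewrite h; ring.
rewrite !inE t2m; move/eqP: m1; rewrite mulf_eq0 => /orP[].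
  by rewrite subr_eq0 => /eqP ->; rewrite [_ == 4](_ : _ = true) ?orbT //; apply/eqP; ring.
by rewrite addr_eq0 => /eqP ->; rewrite [_ == 0](_ : _ = true) //; apply/eqP; ring.
Qed.

Hypothesis unit2 : (2 : R) \is a GRing.unit.

(* Gauss reduction: shear [e] modulo [c] into the window centred at half the
   exponent of the discriminant, which makes [b] narrower than [c]; swap. *)
Lemma unit_disc_represents_unit e b c : e ^+ 2 + b * c \is a GRing.unit ->
  represents_unit e b c.
Proof.
have b0_case e' c' : e' ^+ 2 \is a GRing.unit -> represents_unit e' 0 c'.
  by rewrite unitrX_pos // => ue; exact: represents_unit_b0.
have [->|c0] := eqVneq c 0.
  rewrite mulr0 addr0 => ue; apply: represents_unit_swap; apply: b0_case.
  by rewrite sqrrN.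
have [z [q [q0 cE]]] := laurent_form c0; have [m] := ubnP (size q).
elim: m z q q0 e b c cE {c0} => // m IHm z q q0 e b c cE sq uD.
have [sq1|sq2] := leqP (size q) 1.
  apply: represents_unit_c; rewrite cE unitrM unit_xz /=.
  have qC := size1_polyC sq1; rewrite qC; apply: unit_C.
  by apply: contraNneq q0 => ->.
have [j [a [a0 DE]]] := laurent_unitE uD.
have [s [d [jE d1]]] : exists s (d : nat), j = 2 * s + d%:Z /\ (d <= 1)%N.
  exists (j %/ 2)%Z, `|(j %% 2)%Z|%N; have := divz_eq j 2; have := modz_ge0 j (d := 2).
  have := ltz_pmod j (d := 2); lia.
have [g [r [sr eE]]] := window_division s z e q0.
apply: (@represents_unit_shear _ (- g)).
have e'E : e + - g * c = x ^ s * lpoly r by rewrite eE cE; ring.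
set b' := b - _ - _.
have D' : (e + - g * c) ^+ 2 + b' * c = e ^+ 2 + b * c by rewrite /b'; ring.
have [b'0|b'0] := eqVneq b' 0.
  by rewrite b'0; apply: b0_case; move: D'; rewrite b'0 mul0r addr0 => ->.
have [w [t [t0 b'E]]] := laurent_form b'0.
apply: represents_unit_swap; apply: (IHm w t) => //; last first.
  by rewrite sqrrN [c * _]mulrC D'.
(* Without the factor [x ^ (2 * s)], the product [b' c] is a polynomial of size at most
   [max(2, 2 * size r - 1)]. Since [size r < size q] and [size q >= 2], this leaves
   [size t < size q]. *)
have key : x ^ (w + z - 2 * s) * lpoly (t * q) = lpoly (a%:P * 'X ^+ d - r ^+ 2).
  have uxs : x ^ (2 * s) \is a GRing.unit := unit_xz _.
  apply: (mulIr uxs); rewrite mulrAC -(exprzDr unit_x) subrK (exprzDr unit_x).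
  rewrite rmorphM mulrACA -b'E -cE.
  have -> : b' * c = e ^+ 2 + b * c - (x ^ s * lpoly r) ^+ 2 by rewrite -e'E -D'; ring.
  rewrite DE jE (exprzDr unit_x) -exprnP exprMn.
  have -> : (x ^ s) ^+ 2 = x ^ (2 * s) by rewrite exprnP exprz_exp mulrC.
  by rewrite rmorphB rmorphM !rmorphXn /=; ring.
have tq0 : (t * q)`_0 != 0 by rewrite coef0M mulf_neq0.
have [n _ /(congr1 (fun p : {poly k} => size p))] := lpoly_form_le tq0 key.
have nz (p : {poly k}) : p`_0 != 0 -> p != 0 by apply: contraNneq => ->; rewrite coef0.
rewrite size_monicM ?monicXn ?nz // size_polyXn /= size_mul ?nz // => sz.
have := leq_trans (size_polyD (a%:P * 'X ^+ d) (- r ^+ 2)) (leqnn _).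
rewrite sz size_polyN => {}sz.
have s1 : (size (a%:P * 'X ^+ d)%R <= 2)%N.
  rewrite mul_polyC (leq_trans (size_scale_leq _ _)) // size_polyXn; lia.
have s2 : (size (r ^+ 2) <= (size r + size r).-1)%N by rewrite expr2 size_mul_leq.
have t1 := nz _ t0; rewrite -size_poly_gt0 in t1.
move: (size q) (size r) (size t) (size (r ^+ 2)) (size (a%:P * _)%R) sq sq2 sr sz s1 s2 t1.
by lia.
Qed.

Lemma unit_disc_conj e b c : e ^+ 2 + b * c \is a GRing.unit ->
  exists2 P, P \in unitmx &
    P *m mx2 e b c (- e) = antidiag (e ^+ 2 + b * c) *m P.
Proof. by move=> uD; apply/represents_unit_conj/unit_disc_represents_unit. Qed.

End LaurentArithmetic.

(** * p-adic integers *)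

Section PadicIntegers.
Variables (p : nat) (p_pr : prime p).
Local Notation Z := (padic_int p_pr).
Implicit Types x y z : Z.

Lemma residue0 n : (0 : Z) n = 0%N.
Proof. by rewrite /= mod0n. Qed.

Lemma residueD x y n : (x + y) n = ((x n + y n) %% p ^ n)%N.
Proof. by []. Qed.

Lemma residueM x y n : (x * y) n = ((x n * y n) %% p ^ n)%N.
Proof. by []. Qed.

Lemma residue_nat m n : (m%:R : Z) n = (m %% p ^ n)%N.
Proof.
elim: m => [|m IHm]; first by rewrite mulr0n residue0 mod0n.
by rewrite mulrSr residueD IHm /= modnDm addn1.
Qed.

Lemma residue_subr0 x y n : ((x - y) n == 0%N) = (x n == y n).
Proof.
have xE : x n = (((x - y)%R n + y n) %% p ^ n)%N by rewrite -residueD subrK.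
apply/eqP/eqP => [d0|xy]; first by rewrite xE d0 add0n residue_mod.
have : ((x - y)%R n + y n == 0 + y n %[mod p ^ n])%N by rewrite -xE xy add0n residue_mod.
by rewrite eqn_modDr residue_mod mod0n => /eqP.
Qed.

Lemma padic_int_dvd x s : x s = 0%N -> exists y, x = p%:R ^+ s * y.
Proof.
move=> xs; have dvd n : (p ^ s %| x (n + s))%N.
  by rewrite /dvdn -(residue_le x (leq_addl n s)) xs.
pose f n := (x (n + s) %/ p ^ s)%N.
have fS n : (f n %% p ^ n = f n)%N.
  by rewrite modn_divl -expnD residue_mod.
have fP n : (f n = f n.+1 %[mod p ^ n])%N.
  rewrite fS modn_divl -expnD -(residue_le x) //.
exists (padic_of p_pr fP); apply: padic_intP => n.
rewrite residueM -natrX residue_nat modnMml /= fS mulnC divnK //.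
by rewrite -residue_le // leq_addr.
Qed.

(** Inverses exist modulo each p^n, and their uniqueness there makes them compatible. *)
Lemma padic_int_unit x : x 1%N != 0%N -> x \is a GRing.unit.
Proof.
move=> x1; have cop n : coprime (x n.+1) (p ^ n.+1).
  rewrite coprime_sym coprime_pexpl // prime_coprime // /dvdn.
  by rewrite -[p in (_ %% p)%N]expn1 -(residue_le x (ltn0Sn n)).
have inv n : exists u, (x n * u = 1 %[mod p ^ n])%N.
  case: n => [|n]; first by exists 0%N; rewrite expn0 !modn1.
  have [|u v uv _] := @egcdnP (x n.+1) (p ^ n.+1).
    by rewrite lt0n; apply: contraNneq x1 => xn; rewrite (residue_le x (ltn0Sn n)) xn mod0n.
  by exists u; rewrite mulnC uv (eqP (cop n)) modnMDl.
have [f fP] := choice inv.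
have coh n : (f n = f n.+1 %[mod p ^ n])%N.
  have h : (x n * f n.+1 = 1 %[mod p ^ n])%N.
    have := fP n.+1; rewrite (residue_le x (leqnSn n)) => /(congr1 (modn^~ (p ^ n)%N)).
    by rewrite modnMml !modn_dvdm // dvdn_exp2l.
  by rewrite -[f n]muln1 -modnMmr -h modnMmr mulnA -modnMml [(f n * _)%N]mulnC fP modnMml mul1n.
apply/unitrP; exists (padic_of p_pr coh).
suff xy : x * padic_of p_pr coh = 1 by split; rewrite // mulrC.
apply: padic_intP => n; rewrite residueM /= modnMmr fP.
by [].
Qed.

Lemma padic_int_neq0 x : x != 0 -> exists n, x n != 0%N.
Proof.
move=> x0; apply: contrapT => nz; move/eqP: x0; apply; apply: padic_intP => n.
by rewrite residue0; apply/eqP/negPn/negP => xn; apply: nz; exists n.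
Qed.

Lemma residue_p_mul x s : (p%:R ^+ s * x) s = 0%N.
Proof. by rewrite residueM -natrX residue_nat modnn mul0n mod0n. Qed.

Lemma padic_int_val x : x != 0 ->
  exists s u, u \is a GRing.unit /\ x = p%:R ^+ s * u.
Proof.
move=> /padic_int_neq0 ex; have [[|s] xs min] := ex_minnP ex.
  by move: xs; rewrite -residue_mod expn0 modn1.
have [y xE] : exists y, x = p%:R ^+ s * y.
  by apply: padic_int_dvd; apply/eqP/negPn/negP => /min; rewrite ltnn.
exists s, y; split=> //; apply: padic_int_unit; apply: contraNneq xs.
move=> /padic_int_dvd[z yE].
by rewrite xE yE mulrA -exprD addn1 residue_p_mul.
Qed.

Lemma padic_int_char0 n : (n.+1%:R : Z) != 0.
Proof.
apply/eqP => /(congr1 (fun x : Z => x n.+1)); rewrite residue0 residue_nat.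
by rewrite modn_small // ltn_expl // prime_gt1.
Qed.

Lemma padic_p_neq0 : (p%:R : Z) != 0.
Proof. by have := padic_int_char0 p.-1; rewrite prednK // prime_gt0. Qed.

Section Divisibility.
Variables m n : nat.
Implicit Types A B : 'M[Z]_(m, n).

Definition mxdvd s A := exists B, A = p%:R ^+ s *: B.

Lemma mxdvdP s A : mxdvd s A <-> forall i j, A i j s = 0%N.
Proof.
split=> [[B ->] i j|A0]; first by rewrite mxE residue_p_mul.
have dv (ij : 'I_m * 'I_n) : exists y, A ij.1 ij.2 = p%:R ^+ s * y by exact/padic_int_dvd/A0.
have [f fP] := choice dv; exists (\matrix_(i, j) f (i, j)).
by apply/matrixP => i j; rewrite !mxE (fP (i, j)).
Qed.

Lemma mxdvdB s A B : mxdvd s (A - B) <-> forall i j, A i j s = B i j s.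
Proof.
rewrite mxdvdP; split=> AB i j; have := AB i j; rewrite !mxE => /eqP e; apply/eqP.
  by rewrite residue_subr0 in e.
by rewrite residue_subr0.
Qed.

Lemma scale_p_inj s : injective ( *:%R (p%:R ^+ s) : 'M[Z]_(m, n) -> 'M[Z]_(m, n)).
Proof.
move=> A B /matrixP AB; apply/matrixP => i j; have := AB i j; rewrite !mxE.
by apply: mulfI; rewrite expf_neq0 // padic_p_neq0.
Qed.

Lemma mxdvd_all A : (forall s, mxdvd s A) -> A = 0.
Proof.
move=> dv; apply/matrixP => i j; rewrite mxE; apply: padic_intP => s.
by rewrite residue0; have /mxdvdP := dv s.
Qed.

Lemma mxdvd_exact A : A != 0 -> exists s B, ~ mxdvd 1 B /\ A = p%:R ^+ s *: B.
Proof.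
move=> A0; have ex : exists t, `[< ~ mxdvd t A >].
  apply: contrapT => nex; move/eqP: A0; apply; apply: mxdvd_all => s.
  by apply: contrapT => nd; apply: nex; exists s; apply/asboolP.
have [[|s] /asboolP ns min] := ex_minnP ex.
  by case: ns; exists A; rewrite expr0 scale1r.
have [B AE] : mxdvd s A.
  by apply: contrapT => /asboolP/min; rewrite ltnn.
exists s, B; split=> // -[W BE]; apply: ns; exists W.
by rewrite AE BE scalerA -exprD addn1.
Qed.

End Divisibility.

End PadicIntegers.

(* Compactness of Z_p^(m x n), in the form of a Koenig argument: a property of
   sets that passes to one half of every splitting is concentrated at a point. *)
Section Compactness.
Variables (p : nat) (p_pr : prime p) (m n : nat).
Local Notation Z := (padic_int p_pr).
Local Notation V := 'M[Z]_(m, n).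
Variable large : set V -> Prop.
Hypothesis large_split : forall A B, large (A `|` B) -> large A \/ large B.
Hypothesis large_sub : forall A B, A `<=` B -> large A -> large B.
Hypothesis large_set0 : ~ large set0.

Lemma large_fiber (T : finType) (f : V -> T) A : large A ->
  exists v, large (A `&` f @^-1` [set v]).
Proof.
move=> lA; suff key (l : seq T) : large (A `&` [set u | f u \in l]) ->
    exists v, large (A `&` f @^-1` [set v]).
  by apply: (key (enum T)); apply: large_sub lA => u Au; split=> //=; rewrite mem_enum.
elim: l => [|v l IHl] lAl; first by case: large_set0; apply: large_sub lAl => u [].
have [lv|/IHl//] : large (A `&` f @^-1` [set v]) \/ large (A `&` [set u | f u \in l]).
  apply: large_split; apply: large_sub lAl => u [Au] /=; rewrite inE => /orP[/eqP fu|fu].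
    by left.
  by right.
by exists v.
Qed.

Definition ball s (b : V) : set V := [set u | mxdvd s (u - b)].

Lemma large_ball : large setT -> exists b, forall s, large (ball s b).
Proof.
move=> lT; pose B s := {b | large (ball s b)}.
have next s (b : B s) : {b' : B s.+1 | ball s (sval b) (sval b')}.
  case: b => b lb /=; apply: cid.
  pose f (u : V) : {ffun 'I_m * 'I_n -> 'I_(p ^ s.+1)} :=
    [ffun ij => Ordinal (residue_lt (u ij.1 ij.2) s.+1)].
  have [v lv] := large_fiber f lb.
  have [b' [bb' fb']] : (ball s b `&` f @^-1` [set v]) !=set0.
    by apply/set0P/eqP => e; rewrite e in lv.
  have lb' : large (ball s.+1 b').
    apply: large_sub lv => u [_ fu]; apply/mxdvdB => i j.
    have := congr1 (fun g : {ffun _} => g (i, j)) (etrans fu (esym fb')).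
    by rewrite !ffunE => /(congr1 val).
  by exists (exist _ b' lb').
have b0 : B 0%N.
  exists 0; apply: large_sub lT => u _; apply/mxdvdB => i j.
  by rewrite mxE residue0 -residue_mod expn0 modn1.
(* Nested large balls; the residues of their centres stabilise and define the limit point. *)
pose b := fix b s : B s := if s is s'.+1 then sval (next s' (b s')) else b0.
have bS s i j : sval (b s) i j s = sval (b s.+1) i j s.
  by have /mxdvdB := svalP (next s (b s)) => ->.
pose c i j s := sval (b s) i j s.
have coh i j s : (c i j s = c i j s.+1 %[mod p ^ s])%N.
  by rewrite /c -residueS residue_mod bS.
exists (\matrix_(i, j) padic_of p_pr (coh i j)) => s.
apply: large_sub (svalP (b s)) => u /mxdvdB ub; apply/mxdvdB => i j.
by rewrite mxE /= ub /c residue_mod.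
Qed.

End Compactness.

(** * Torsion matrices over Z_p have bounded order *)

Section IntegralTorsion.
Variables (p : nat) (p_pr : prime p) (N : nat).
Local Notation Z := (padic_int p_pr).
Local Notation M := 'M[Z]_N.
Implicit Types Y G : M.

Lemma expr1D (S : pzRingType) (X : S) n :
  exists W, (1 + X) ^+ n = 1 + X *+ n + X ^+ 2 * W.
Proof.
elim: n => [|n [W IHn]]; first by exists 0; rewrite expr0 mulr0n mulr0 !addr0.
exists (n%:R + W + X * W); rewrite exprS IHn mulrDl mul1r !mulrDr mulr1.
have -> : X * (X ^+ 2 * W) = X ^+ 2 * (X * W) by rewrite expr2 !mulrA.
rewrite mulr_natr mulrnAr -expr2 mulrSr -!addrA; congr (1 + (X *+ n + _)).
by rewrite addrCA; congr (X + _); rewrite addrCA.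
Qed.

(* A matrix [1 + p^a Y] with [a >= 2] and [Y] nonzero mod [p]: an exponent prime
   to [p] keeps this form, and raising to the power [p] only increases [a]. *)
Lemma one_add_torsionfree Y a n : (1 < a)%N -> ~ mxdvd 1 Y ->
  (1 + p%:R ^+ a *: Y) ^+ n.+1 <> 1.
Proof.
have [k] := ubnP n; elim: k n a Y => // k IHk n a Y nk a2 nY.
have sq W : (p%:R ^+ a *: Y) ^+ 2 * W = p%:R ^+ (a + a) *: (Y ^+ 2 * W).
  by rewrite !expr2 -!mulmxE -!scalemxAl -!scalemxAr -scalemxAl scalerA exprD.
have [pn|npn] := boolP (p %| n.+1)%N; last first.
  have [W ->] := expr1D (p%:R ^+ a *: Y) n.+1.
  rewrite -addrA => /(canRL (addKr _)); rewrite addNr sq => e; apply: nY.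
  have : p%:R ^+ a *: (Y *+ n.+1 + p%:R ^+ a *: (Y ^+ 2 * W)) = p%:R ^+ a *: 0.
    by rewrite scaler0 -e scalerDr scalerA -exprD scalerMnr.
  move=> /scale_p_inj/eqP; rewrite addr_eq0 -scaler_nat => /eqP e1.
  have un : (n.+1%:R : Z) \is a GRing.unit.
    by apply: padic_int_unit; rewrite residue_nat expn1.
  exists ((- n.+1%:R^-1 * p%:R ^+ a.-1) *: (Y ^+ 2 * W)).
  have YE : Y = n.+1%:R^-1 *: ((n.+1%:R : Z) *: Y) by rewrite scalerA mulVr // scale1r.
  rewrite {1}YE e1 -scaleNr !scalerA; congr (_ *: _).
  have -> : (p%:R : Z) ^+ a = p%:R ^+ 1 * p%:R ^+ a.-1.
    by rewrite -exprD add1n prednK // ltnW.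
  by ring.
case/dvdnP: pn => -[|q] qE; first by [].
have [W pE] := expr1D (p%:R ^+ a *: Y) p.
rewrite qE mulnC exprM pE.
(* Here [1 < a] matters: [p^(2a)] is divisible by [p^(a+2)], so the new [Y] is unchanged modulo p.
   For p = 2 and a = 1 the claim fails at -1. *)
have -> : 1 + (p%:R ^+ a *: Y) *+ p + (p%:R ^+ a *: Y) ^+ 2 * W
  = 1 + p%:R ^+ a.+1 *: (Y + p%:R ^+ 1 *: (p%:R ^+ (a - 2) *: (Y ^+ 2 * W))).
  rewrite sq -addrA scalerDr !scalerA -!exprD -scaler_nat scalerA -exprS.
  by congr (_ + (_ + _ *: _)); congr (_ ^+ _); lia.
apply: IHk; [| by rewrite ltnW |].
  by have := prime_gt1 p_pr; move: nk; rewrite ltnS => nk; nia.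
move=> [U UE]; apply: nY; exists (U - p%:R ^+ (a - 2) *: (Y ^+ 2 * W)).
by rewrite scalerBr -UE addrK.
Qed.

(** Two of the first [#|T| + 1] powers of [G] agree modulo p^2, and the kernel of reduction modulo
    p^2 has no torsion. So some power [G ^+ s] with [0 < s <= #|T|] is 1. *)
Lemma integral_torsion_exponent :
  exists2 E, (0 < E)%N & forall G n, G ^+ n.+1 = 1 -> G ^+ E = 1.
Proof.
pose T : finType := {ffun 'I_N * 'I_N -> 'I_(p ^ 2)}.
exists (#|T|)`!; first exact: fact_gt0.
move=> G n Gn; pose f (A : M) : T :=
  [ffun ij => Ordinal (residue_lt (A ij.1 ij.2) 2)].
have /injectivePn[i [j ij fij]] : ~~ injectiveb (fun i : 'I_(#|T|).+1 => f (G ^+ i)).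
  by apply/negP => /injectiveP/leq_card; rewrite card_ord ltnn.
wlog ltij : i j ij fij / (i < j)%N.
  move=> W; case: (ltngtP i j) => [|ji|/val_inj e]; first exact: W.
    by apply: (W j i) => //; rewrite eq_sym.
  by rewrite e eqxx in ij.
pose s := (j - i)%N.
have dij : mxdvd 2 (G ^+ j - G ^+ i).
  apply/mxdvdB => a b; have := congr1 (fun g : {ffun _} => g (a, b)) fij.
  by rewrite !ffunE => /(congr1 val) /= ->.
have [Y GsE] : mxdvd 2 (G ^+ s - 1).
  (* [G ^+ (n * i)] is the inverse of [G ^+ i]. *)
  have [U UE] := dij; exists (G ^+ (n * i) * U).
  rewrite -mulmxE scalemxAr -UE mulmxE mulrBr -!exprD.
  have -> : (n * i + i = n.+1 * i)%N by lia.
  have -> : (n * i + j = n.+1 * i + s)%N by rewrite /s; lia.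
  by rewrite exprD !exprM Gn !expr1n mul1r.
have Gs1 : G ^+ s = 1.
  have Gs : G ^+ s = 1 + p%:R ^+ 2 *: Y by rewrite -GsE addrC subrK.
  have [Y0|/mxdvd_exact[a [Y' [nY' YE]]]] := eqVneq Y 0.
    by rewrite Gs Y0 scaler0 addr0.
  have := @one_add_torsionfree Y' (2 + a) n ltac:(by []) nY'.
  by rewrite exprD -scalerA -YE -Gs -exprM mulnC exprM Gn expr1n.
have /dvdnP[q ->] : (s %| (#|T|)`!)%N.
  by apply: dvdn_fact; rewrite subn_gt0 ltij /= leq_subLR (leq_trans _ (leq_addl _ _)) // -ltnS.
by rewrite mulnC exprM Gs1 expr1n.
Qed.

End IntegralTorsion.

Lemma fraction_numden (R : idomainType) (q : {fraction R}) :
  exists a b, b != 0 /\ q = tofrac a / tofrac b.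
Proof.
elim/quotW: q => x; exists (\n_x), (\d_x); split; first exact: denom_ratioP.
have d0 : tofrac (\d_x) != 0 by rewrite tofrac_eq0 denom_ratioP.
apply: (mulIf d0); rewrite divfK // -[LHS]/(FracField.mul _ _).
rewrite !piE; apply/eqmodP; rewrite /= FracField.equivfE /FracField.mulf.
by rewrite !numden_Ratio ?(oner_eq0, mulf_neq0, denom_ratioP) // !mulr1 mulrC.
Qed.

Lemma padic_denominator (p : nat) (p_pr : prime p) (q : padic p_pr) :
  exists s a, q * tofrac p%:R ^+ s = tofrac a.
Proof.
have [a [b [b0 ->]]] := fraction_numden q.
have [s [u [uu bE]]] := padic_int_val b0; exists s, (a * u^-1).
have p0 : tofrac (p%:R : padic_int p_pr) ^+ s != 0.
  by rewrite expf_neq0 // tofrac_eq0 padic_p_neq0.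
rewrite tofracM (rmorphV _ uu) bE tofracM tofracXn invfM !mulrA mulrAC.
by rewrite mulfVK.
Qed.

(** * Torsion matrices over Q_p have bounded order *)

Section RationalTorsion.
Variables (p : nat) (p_pr : prime p) (Q : fieldType).
Variable iota : {rmorphism padic_int p_pr -> Q}.
Hypothesis iota_inj : injective iota.
Hypothesis denominator : forall q : Q, exists s a, q * iota p%:R ^+ s = iota a.
Local Notation Z := (padic_int p_pr).

Lemma iota_eq0 a : (iota a == 0) = (a == 0).
Proof. by rewrite -(rmorph0 iota) (inj_eq iota_inj). Qed.

Lemma iota_p_neq0 s : iota p%:R ^+ s != 0.
Proof. by rewrite expf_neq0 // iota_eq0 padic_p_neq0. Qed.

Lemma padic_int_dvd_total (a b : Z) : (exists c, a = c * b) \/ (exists c, b = c * a).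
Proof.
have [->|a0] := eqVneq a 0; first by left; exists 0; rewrite mul0r.
have [->|b0] := eqVneq b 0; first by right; exists 0; rewrite mul0r.
have [s [u [uu aE]]] := padic_int_val a0; have [t [v [uv bE]]] := padic_int_val b0.
wlog st : a b s t u v {a0 b0} aE bE uu uv / (s <= t)%N.
  move=> W; case/orP: (leq_total s t) => st; first exact: (W a b s t u v).
  by case: (W b a t s v u) => //; [right | left].
right; exists (p%:R ^+ (t - s) * v / u).
rewrite aE bE; transitivity (p%:R ^+ (t - s) * p%:R ^+ s * v * (u^-1 * u)).
  by rewrite -exprD subnK // mulVr // mulr1.
by ring.
Qed.

(** The comparison of p-adic absolute values, written without division so that [y = 0] is
    allowed. *)
Definition quot_integral (x y : Q) := exists z : Z, x = iota z * y.

Lemma quot_integral_total x y : quot_integral x y \/ quot_integral y x.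
Proof.
have [s [a xE]] := denominator x; have [t [b yE]] := denominator y.
have key (z w : Q) (m n : nat) c d e : z * iota p%:R ^+ m = iota c ->
    w * iota p%:R ^+ n = iota d -> c * p%:R ^+ n = e * (d * p%:R ^+ m) ->
    quot_integral z w.
  move=> zE wE cd; exists e; apply: (mulIf (iota_p_neq0 (m + n))).
  rewrite exprD mulrA zE -rmorphXn -rmorphM cd !rmorphM -wE !rmorphXn; ring.
case: (padic_int_dvd_total (a * p%:R ^+ t) (b * p%:R ^+ s)) => -[e eE].
  by left; exact: key eE.
by right; exact: key eE.
Qed.

Lemma quot_integral_trans y x z :
  quot_integral x y -> quot_integral y z -> quot_integral x z.
Proof. by move=> [a ->] [b ->]; exists (a * b); rewrite rmorphM mulrA. Qed.

Lemma exists_quot_integral_max (I : finType) (i0 : I) (f : I -> Q) :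
  exists i, forall j, quot_integral (f j) (f i).
Proof.
suff key (l : seq I) : exists i, forall j, j \in l -> quot_integral (f j) (f i).
  by have [i iP] := key (enum I); exists i => j; apply: iP; rewrite mem_enum.
elim: l => [|j l [i iP]]; first by exists i0.
have refl x : quot_integral x x by exists 1; rewrite rmorph1 mul1r.
case: (quot_integral_total (f i) (f j)) => ij.
  exists j => h; rewrite inE => /orP[/eqP -> //|hl].
  exact: quot_integral_trans (iP h hl) ij.
by exists i => h; rewrite inE => /orP[/eqP -> //|/iP].
Qed.

(* Among all bases consisting of rows of powers of [g], take one whose
   determinant has maximal absolute value: by Cramer's rule every such row has
   integral coordinates in it, so [g] becomes integral in this basis. *)
Lemma torsion_integral N (g : 'M[Q]_N) n : g ^+ n.+1 = 1 ->
  exists2 B, B \in unitmx & exists G : 'M[Z]_N, B *m g = map_mx iota G *m B.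
Proof.
move=> gn.
pose B (h : {ffun 'I_N -> 'I_n.+1 * 'I_N}) := \matrix_(l, j) (g ^+ (h l).1) (h l).2 j.
have [h hmax] := exists_quot_integral_max [ffun l => (ord0, l)] (fun h => \det (B h)).
have dB : \det (B h) != 0.
  (* The rows of [g ^+ 0] give determinant 1, which is a multiple of the maximal determinant. *)
  have [z] := hmax [ffun l => (ord0, l)].
  have -> : B [ffun l => (ord0, l)] = 1%:M.
    by apply/matrixP => a b; rewrite mxE ffunE expr0.
  by rewrite det1; apply: contra_eq_neq => ->; rewrite mulr0 oner_neq0.
have uB : B h \in unitmx by rewrite unitmxE unitfE.
exists (B h) => //.
have rowint (i : 'I_n.+1) (a l : 'I_N) :
    exists z, (row a (g ^+ i) *m invmx (B h)) 0 l = iota z.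
  pose h' := [ffun l' => if l' == l then (i, a) else h l'].
  have [z zE] := hmax h'; exists z.
  rewrite /invmx uB -scalemxAr mxE; apply: (mulfI dB); rewrite mulVKf // mulrC -zE.
  rewrite (expand_det_row _ l) mxE; apply: eq_bigr => j _.
  rewrite !mxE ffunE eqxx /=; congr (_ * _); rewrite /cofactor; congr (_ * \det _).
  by apply/matrixP => b c; rewrite !mxE ffunE eq_sym (negbTE (neq_lift _ _)).
have entry (li : 'I_N * 'I_N) : exists z, (B h *m g *m invmx (B h)) li.1 li.2 = iota z.
  (* As [g ^+ n.+1 = 1], the exponent can be reduced modulo [n.+1], so a row of [B h *m g] is again
     a row of an allowed power. *)
  case: li => l m /=; pose i' : 'I_n.+1 := inord ((h l).1.+1 %% n.+1).
  have [z zE] := rowint i' (h l).2 m; exists z; rewrite -zE.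
  have gi : g ^+ i' = g ^+ (h l).1 *m g.
    by rewrite /i' inordK ?ltn_pmod // expr_mod //; exact: exprSr.
  transitivity ((row l (B h *m g *m invmx (B h))) 0 m); first by rewrite [RHS]mxE.
  rewrite gi !row_mul; congr ((_ *m _ *m _) _ _).
  by apply/rowP => c; rewrite !mxE.
have [f fP] := choice entry; exists (\matrix_(l, m) f (l, m)).
rewrite -[LHS](mulmxKV uB); congr (_ *m _).
by apply/matrixP => l m; rewrite (fP (l, m)) !mxE.
Qed.

Lemma torsion_exponent N :
  exists2 E, (0 < E)%N & forall (g : 'M[Q]_N) n, g ^+ n.+1 = 1 -> g ^+ E = 1.
Proof.
have [E E0 EP] := integral_torsion_exponent p_pr N; exists E => // g n gn.
have [B uB [G BG]] := torsion_integral gn.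
have BGX k : B *m g ^+ k = map_mx iota (G ^+ k) *m B.
  elim: k => [|k IHk]; first by rewrite !expr0 map_mx1 mulmx1 mul1mx.
  by rewrite !exprSr -!mulmxE mulmxA IHk -mulmxA BG mulmxA map_mxM.
have Gn : G ^+ n.+1 = 1.
  have e : map_mx iota (G ^+ n.+1) = 1%:M.
    by rewrite -[LHS](mulmxK uB) -BGX gn mulmx1 mulmxV.
  apply/matrixP => i j; apply: iota_inj; move/matrixP: e => /(_ i j).
  by rewrite !mxE rmorph_nat.
rewrite -[LHS](mulKmx uB) BGX (EP _ _ Gn) map_mx1 mul1mx mulVmx //.
Qed.

End RationalTorsion.

(** * Square classes *)

Section SquareClasses.
Variables (p : nat) (p_pr : prime p) (F : fieldType) (d : nat).
Local Notation Z := (padic_int p_pr).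
Local Notation V := 'rV[Z]_d.
Variable lat : {additive V -> F}.
Hypothesis lat_inj : injective lat.
Hypothesis lat_mul : forall u v, exists w, lat u * lat v = lat w.
Hypothesis lat_denominator : forall a, exists s u, a * p%:R ^+ s = lat u.
Hypothesis char0 : forall n, (n.+1%:R : F) != 0.
Implicit Types u v w : V.

Local Notation pi := (p%:R : F).

Lemma pi_neq0 s : pi ^+ s != 0.
Proof. by rewrite expf_neq0 // -(prednK (prime_gt0 p_pr)). Qed.

Lemma latMn m u : lat (m%:R *: u) = m%:R * lat u.
Proof. by rewrite scaler_nat raddfMn mulr_natl. Qed.

Lemma latMp s u : lat (p%:R ^+ s *: u) = pi ^+ s * lat u.
Proof. by rewrite -natrX latMn natrX. Qed.

Lemma lat_eq0_of_dvd u : (forall s, exists w, lat u = pi ^+ s * lat w) -> u = 0.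
Proof.
move=> du; apply: mxdvd_all => s; have [w uw] := du s.
by exists w; apply: lat_inj; rewrite latMp.
Qed.

(** A zero gives [(1 + 2 pi lat u)^2 = 1 + 4 pi lat v]. In terms of [y = pi lat u] the derivative
    [2 y + 1] is 1 modulo pi, also for p = 2. *)
Definition quad v u := (pi * lat u) ^+ 2 + pi * lat u - pi * lat v.

Lemma quad_lat v u : exists w, quad v u = lat w.
Proof.
have [w wE] := lat_mul (p%:R ^+ 1 *: u) (p%:R ^+ 1 *: u).
exists (w + p%:R ^+ 1 *: u - p%:R ^+ 1 *: v).
by rewrite raddfB raddfD /= -wE !latMp expr1 /quad expr2.
Qed.

Lemma quad_shift v u w s : exists w', quad v (u + p%:R ^+ s *: w) = quad v u + pi ^+ s * lat w'.
Proof.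
have [a aE] := lat_mul u w; have [b bE] := lat_mul w w.
exists ((p ^ 2 * 2)%:R *: a + (p ^ (s + 2))%:R *: b + p%:R *: w).
rewrite !raddfD /= !latMn -aE -bE /quad raddfD /= latMp natrM !natrX exprD; ring.
Qed.

Lemma quad_approx v s : exists u w, quad v u = pi ^+ s * lat w.
Proof.
suff [u [w uE]] : exists u w, quad v u = pi ^+ s.+1 * lat w.
  by exists u, (p%:R ^+ 1 *: w); rewrite uE latMp mulrA -exprD addn1.
elim: s => [|s [u [w uE]]].
  exists 0, (- v); rewrite /quad raddf0 raddfN /=; ring.
have [a aE] := lat_mul w w; have [b bE] := lat_mul u w.
(* Newton's step with the derivative replaced by 1. For [f(y) = y^2 + y - z] one has
   [f(y - f(y)) = f(y) (f(y) - 2 y)], and the second factor contributes one more pi. *)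
exists (u - p%:R ^+ s *: w), ((p ^ s)%:R *: a - 2%:R *: b).
rewrite raddfB /= !latMn -aE -bE natrX.
transitivity (quad v u * (quad v u - 2 * pi * lat u)).
  have e : pi * (lat u - pi ^+ s * lat w) = pi * lat u - quad v u.
    by rewrite uE exprS; ring.
  by rewrite {1}/quad raddfB /= latMp e /quad; ring.
by rewrite uE !exprS; ring.
Qed.

(* Newton's iteration for [y^2 + y = z] with [z] in [pi L]; its limit is taken
   by compactness. *)
Lemma one_add_4pi_square v : exists c, 1 + 4 * pi * lat v = c ^+ 2.
Proof.
pose large (A : set V) := forall s, exists2 u, A u & exists w, quad v u = pi ^+ s * lat w.
have weaken s t u : (exists w, quad v u = pi ^+ (s + t) * lat w) ->
    exists w, quad v u = pi ^+ s * lat w.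
  by move=> [w ->]; exists (p%:R ^+ t *: w); rewrite latMp mulrA -exprD.
have [] := @large_ball p p_pr 1 d large.
- move=> A B lAB; apply: contrapT => /not_orP[nA nB].
  have /existsNP[s ns] := nA; have /existsNP[t nt] := nB.
  have [u [Au|Bu] dv] := lAB (s + t)%N.
    by apply: ns; exists u => //; exact: weaken dv.
  by apply: nt; exists u => //; rewrite addnC in dv; exact: weaken dv.
- by move=> A B AB lA s; have [u Au dv] := lA s; exists u => //; exact: AB.
- by move=> /(_ 0%N)[].
- by move=> s; have [u dv] := quad_approx v s; exists u.
move=> b lb; suff b0 : quad v b = 0.
  exists (1 + 2 * (pi * lat b)); transitivity (1 + 4 * pi * lat v + 4 * quad v b).
    by rewrite b0 mulr0 addr0.
  by rewrite /quad; ring.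
have [c cE] := quad_lat v b; rewrite cE; suff -> : c = 0 by rewrite raddf0.
apply: lat_eq0_of_dvd => s; have [u [w ub] [w1 uE]] := lb s s.
have [w2 E] := quad_shift v b w s; exists (w1 - w2).
have {}ub : u = b + p%:R ^+ s *: w by rewrite -ub addrC subrK.
rewrite -cE raddfB /= mulrBr -uE ub E; ring.
Qed.

(** Dividing by an even power of p keeps the square class, so every class is represented away from
    0, outside p^2 times the lattice. *)
Lemma lat_mod_p2 u : u != 0 ->
  exists j w, ~ mxdvd 2 w /\ u = p%:R ^+ (2 * j) *: w.
Proof.
move=> /mxdvd_exact[s [w [nw ->]]].
have [j [e [sE e1]]] : exists j e, (s = 2 * j + e)%N /\ (e <= 1)%N.
  by exists (s %/ 2)%N, (s %% 2)%N; lia.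
exists j, (p%:R ^+ e *: w); split; last by rewrite scalerA -exprD -sE.
move=> [w' wE]; apply: nw; exists (p%:R ^+ (1 - e) *: w').
apply: (@scale_p_inj _ p_pr _ _ e); rewrite wE !scalerA -!exprD.
by congr (_ ^+ _ *: _); lia.
Qed.

(* By compactness it suffices to see that the square class is constant near each
   [b <> 0]: there [lat u / lat b = 1 + 4 pi v] with [v] integral. *)
Lemma finite_square_classes :
  exists dk : seq F, forall a, a != 0 -> exists2 c, c != 0 & c ^+ 2 * a \in dk.
Proof.
pose small (A : set V) := exists dk : seq F, forall u, A u -> ~ mxdvd 2 u ->
  exists2 c, c != 0 & c ^+ 2 * lat u \in dk.
have [[dk dkP]|big] := pselect (small setT).
  exists dk => a a0; have [s [u0 aE]] := lat_denominator a.
  (* A second factor [p ^+ s] makes the total scaling of [a] a square. *)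
  have u0E : lat (p%:R ^+ s *: u0) = a * pi ^+ (2 * s).
    by rewrite latMp -aE mul2n -addnn exprD; ring.
  have nz : p%:R ^+ s *: u0 != 0.
    apply: contra_eq_neq u0E => ->; rewrite raddf0 eq_sym.
    by rewrite mulf_neq0 // pi_neq0.
  have [j [w [nw wE]]] := lat_mod_p2 nz.
  have [c c0 cdk] := dkP w I nw.
  exists (c * pi ^+ s / pi ^+ j); first by rewrite !mulf_neq0 ?invr_neq0 ?pi_neq0.
  suff -> : (c * pi ^+ s / pi ^+ j) ^+ 2 * a = c ^+ 2 * lat w by [].
  have -> : lat w = lat (p%:R ^+ s *: u0) / pi ^+ (2 * j).
    by rewrite wE latMp mulrC mulKf ?pi_neq0.
  rewrite u0E !exprMn exprVn -!exprM ![(2 * _)%N]mulnC; ring.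
have [||||b lb] := @large_ball p p_pr 1 d (fun A => ~ small A).
- move=> A B nAB; apply: contrapT => /not_orP[/contrapT[dA HA] /contrapT[dB HB]].
  apply: nAB; exists (dA ++ dB) => u [Au|Bu] nu.
    by have [c c0 cd] := HA u Au nu; exists c; rewrite // mem_cat cd.
  by have [c c0 cd] := HB u Bu nu; exists c; rewrite // mem_cat cd orbT.
- move=> A B AB nA [dB HB]; apply: nA; exists dB => u Au; exact/HB/AB.
- by apply; exists [::].
- exact: big.
(* Near a multiple of p^2 all points are multiples of p^2, on which [small] imposes nothing. *)
have b0 : lat b != 0.
  have nb : ~ mxdvd 2 b.
    move=> db; apply: (lb 2%N); exists [::] => u ub nu; case: nu.
    by rewrite -[u](subrK b); case: ub => x ->; case: db => y ->; exists (x + y); rewrite scalerDr.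
  apply: contra_notN nb => /eqP lb0.
  have -> : b = 0 by apply: lat_inj; rewrite lb0 raddf0.
  by exists 0; rewrite scaler0.
have [r [t tE]] := lat_denominator (lat b)^-1.
have [m [z m4]] : exists m z, (p%:R : Z) ^+ m = 4 * z.
  have [m [x [ux E]]] := padic_int_val (padic_int_char0 p_pr 3).
  by exists m, x^-1; rewrite E mulrK.
(* [r] clears the denominator of [(lat b)^-1], [m] provides the factor 4, and the final 1 the factor
   pi required by [one_add_4pi_square]. *)
exfalso; apply: (lb (r + (m + 1))%N); exists [:: lat b] => u [w ub] nu.
have [a aE] := lat_mul w t.
have [c cE] := one_add_4pi_square (z *: a).
have ubE : lat u = lat b * c ^+ 2.
  have -> : u = b + p%:R ^+ (r + (m + 1)) *: w by rewrite -ub addrC subrK.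
  rewrite raddfD /= latMp -cE.
  have -> : 4 * pi * lat (z *: a) = pi ^+ m * pi * lat a.
    transitivity (pi * lat (p%:R ^+ m *: a)); last by rewrite latMp; ring.
    by rewrite m4 -scalerA latMn; ring.
  by rewrite -aE -tE !exprD expr1; field.
have u0 : lat u != 0.
  apply: contra_notN nu => /eqP lu0.
  have -> : u = 0 by apply: lat_inj; rewrite lu0 raddf0.
  by exists 0; rewrite scaler0.
have c0 : c != 0 by apply: contraNneq u0 => c0; rewrite ubE c0 expr0n mulr0.
exists c^-1; first by rewrite invr_eq0.
by rewrite inE ubE exprVn mulrC mulfK // expf_neq0.
Qed.

End SquareClasses.

(** * Finite extensions of the p-adic numbers *)

Lemma finite_roots (F : fieldType) (q : {poly F}) : q != 0 ->
  exists s : seq F, forall x, root q x -> x \in s.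
Proof.
have [m] := ubnP (size q); elim: m q => // m IHm q sq q0.
have [[x qx]|no] := pselect (exists x, root q x); last first.
  by exists [::] => x qx; case: no; exists x.
have /factor_theorem[r qE] := qx.
have r0 : r != 0 by apply: contraNneq q0 => r0; rewrite qE r0 mul0r.
have [|s sP] := IHm r _ r0.
  by move: sq; rewrite qE size_mul ?polyXsubC_eq0 // size_XsubC addn2.
exists (x :: s) => y; rewrite qE rootM root_XsubC inE => /orP[/sP -> |->] //.
by rewrite orbT.
Qed.

(** Cassini's identity, the determinant of a power of a matrix in SL_2; at a zero of [chebU t n.+1]
    it gives [chebU t n ^+ 2 = 1]. *)
Lemma chebU_det (S : comNzRingType) (t : S) n :
  chebU t n.+1 ^+ 2 - chebU t n * chebU t n.+2 = 1.
Proof.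
elim: n => [|n IHn]; first by rewrite /= mul0r subr0 expr1n.
rewrite -IHn (chebUSS t n.+1) (chebUSS t n); ring.
Qed.

Section PadicExtension.
Variables (p : nat) (p_pr : prime p) (k : fieldExtType (padic p_pr)).
Local Notation Z := (padic_int p_pr).
Local Notation Q := (padic p_pr).
Local Notation iota := (@tofrac Z).
Local Notation pi := (iota p%:R).

Lemma iota_inj : injective iota.
Proof. by move=> a b /eqP; rewrite tofrac_eq => /eqP. Qed.

Lemma padic_char0 n : (n.+1%:R : Q) != 0.
Proof. by rewrite -(rmorph_nat iota) tofrac_eq0 padic_int_char0. Qed.

Lemma ext_char0 n : (n.+1%:R : k) != 0.
Proof. by rewrite -(rmorph_nat (in_alg k)) fmorph_eq0 padic_char0. Qed.

Section Companion.
Variable t : k.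
(** Multiplication by [z] on [k[z] / (z^2 - t z + 1)], regarded as a Q_p-linear map so that the
    torsion bound over Q_p applies. *)
Definition companion (v : k * k) : k * k := (- v.2, v.1 + t * v.2).

Lemma companion_linear : linear companion.
Proof.
move=> a [x y] [x' y']; congr pair.
  rewrite -[LHS]/(- (a *: y + y')) -[RHS]/(a *: - y + - y').
  by rewrite opprD scalerN.
rewrite -[LHS]/(a *: x + x' + t * (a *: y + y')).
rewrite -[RHS]/(a *: (x + t * y) + (x' + t * y')).
by rewrite mulrDr scalerDr -scalerAr addrACA.
Qed.
HB.instance Definition _ := GRing.isLinear.Build Q _ _ _ companion companion_linear.

Definition companion_row : 'rV[Q]_(dim (k * k)%type) -> 'rV[Q]_(dim (k * k)%type) :=
  v2r \o companion \o r2v.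

Definition companion_mx := lin1_mx companion_row.

Lemma companion_mxX n v : v *m companion_mx ^+ n = v2r (iter n companion (r2v v)).
Proof.
elim: n => [|n IHn]; first by rewrite expr0 mulmx1 r2vK.
by rewrite exprSr -mulmxE mulmxA IHn mul_rV_lin1 /companion_row /= v2rK.
Qed.

Lemma iter_companion n a b : iter n.+1 companion (a, b) =
  (- chebU t n.+1 * b - chebU t n * a, chebU t n.+1 * (a + t * b) - chebU t n * b).
Proof.
elim: n => [|n IHn]; first by rewrite /companion /=; congr pair; ring.
by rewrite iterS IHn (chebUSS t n) /companion /=; congr pair; ring.
Qed.

(** At a zero of [chebU t n.+1] the power [n.+1] is the scalar [- chebU t n], a sign; hence the
    factor 2. *)
Lemma companion_mx_torsion n : chebU t n.+1 = 0 -> companion_mx ^+ (2 * n.+1) = 1.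
Proof.
move=> U0; have U1 : chebU t n ^+ 2 = 1.
  by have := chebU_det t n; rewrite chebUSS U0 mulr0 sub0r mulrN opprK expr0n add0r -expr2.
have it v : iter n.+1 companion v = (- chebU t n * v.1, - chebU t n * v.2).
  by case: v => a b; rewrite iter_companion U0 !mul0r oppr0 mul0r !sub0r mulNr mulNr.
apply/row_matrixP => i; rewrite !rowE companion_mxX mulmx1; set w := r2v _.
suff -> : iter (2 * n.+1) companion w = w by rewrite r2vK.
rewrite iterM -[LHS]/(iter n.+1 companion (iter n.+1 companion w)) !it.
by case: w => x y; rewrite -[fst _]/(- chebU t n * x) -[snd _]/(- chebU t n * y)
  !mulrA mulrNN -expr2 U1 !mul1r.
Qed.

End Companion.

(** The size of the companion matrix over Q_p does not depend on [t], so one exponent serves every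
    [t], and all of them are zeros of a single Chebyshev polynomial. *)
Lemma chebU_roots : exists tk : seq k, forall t n, chebU t n.+1 = 0 -> t \in tk.
Proof.
have [E E0 EP] := torsion_exponent iota_inj (@padic_denominator p p_pr) (dim (k * k)%type).
case: E E0 EP => // E _ EP.
have [mE _] := chebUX_monic k E.
have [tk tkP] := finite_roots (monic_neq0 mE).
exists tk => t n U0; apply: tkP; rewrite /root -[X in X == 0]/(horner_eval t _).
rewrite (rmorph_chebU (horner_eval t)) [X in chebU X _](hornerX _).
have gE : companion_mx t ^+ E.+1 = 1.
  by apply: (EP _ (2 * n.+1).-1); rewrite prednK // companion_mx_torsion.
have := companion_mxX t E.+1 (v2r ((1, 0) : k * k)).
rewrite gE mulmx1 v2rK iter_companion => /(can_inj (@v2rK _ _))/(congr1 snd).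
rewrite -[LHS]/(0 : k) -[RHS]/(chebU t E.+1 * (1 + t * 0) - chebU t E * 0).
by rewrite !mulr0 addr0 mulr1 subr0 => <-.
Qed.

Local Notation d := (\dim {:k}).
Local Notation e := (vbasis {:k}).

Lemma common_denominator (I : finType) (q : I -> Q) :
  exists N, forall i, exists a, q i * pi ^+ N = iota a.
Proof.
have [s sP] := choice (fun i => padic_denominator (q i)).
exists (\sum_i s i)%N => i; have [a aE] := sP i.
exists (a * p%:R ^+ (\sum_(j | j != i) s j)%N).
by rewrite (bigD1 i) //= exprD mulrA aE -tofracXn -tofracM.
Qed.

Section Lattice.
Variable N : nat.
Hypothesis structure_constants : forall i j l : 'I_d,
  exists a, coord e l (e`_i * e`_j) * pi ^+ N = iota a.

(** Scaling a basis by [pi ^+ N] multiplies its structure constants by [pi ^+ N]; they become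
    integral and the lattice is closed under products. *)
Definition lat (u : 'rV[Z]_d) : k := \sum_i (iota (u 0 i) * pi ^+ N) *: e`_i.

Lemma lat_is_zmod_morphism : zmod_morphism lat.
Proof.
move=> u v; rewrite /lat -sumrB; apply: eq_bigr => i _.
by rewrite -scalerBl -mulrBl -tofracB !mxE.
Qed.
HB.instance Definition _ := GRing.isZmodMorphism.Build _ _ lat lat_is_zmod_morphism.

Lemma coord_lat u l : coord e l (lat u) = iota (u 0 l) * pi ^+ N.
Proof.
exact: coord_sum_free (basis_free (vbasisP _)).
Qed.

Lemma pi_pow_neq0 s : pi ^+ s != 0.
Proof. by rewrite expf_neq0 // tofrac_eq0 padic_p_neq0. Qed.

Lemma lat_inj : injective lat.
Proof.
move=> u v uv; apply/rowP => l; apply: iota_inj; apply: (mulIf (pi_pow_neq0 N)).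
by rewrite -!coord_lat uv.
Qed.

Lemma latP a : (forall l, exists z, coord e l a = iota z * pi ^+ N) ->
  exists u, a = lat u.
Proof.
move=> /choice[f fP]; exists (\row_l f l); rewrite {1}(coord_vbasis (memvf a)) /lat.
by apply: eq_bigr => i _; rewrite fP mxE.
Qed.

Lemma lat_mul u v : exists w, lat u * lat v = lat w.
Proof.
apply: latP => l; rewrite /lat mulr_suml linear_sum /=.
pose P (q : Q) := exists z, q = iota z * pi ^+ N.
have PD x y : P x -> P y -> P (x + y).
  by move=> [a ->] [b ->]; exists (a + b); rewrite tofracD mulrDl.
have P0 : P 0 by exists 0; rewrite tofrac0 mul0r.
apply: (big_ind P) => // i _; rewrite mulr_sumr linear_sum /=.
apply: (big_ind P) => // j _; have [a aE] := structure_constants i j l.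
exists (u 0 i * v 0 j * a); rewrite -scalerAl -scalerAr scalerA linearZ /=.
by rewrite !tofracM -aE; ring.
Qed.

Lemma lat_denominator a : exists s u, a * p%:R ^+ s = lat u.
Proof.
have [s sP] := common_denominator (fun l => coord e l a).
exists (s + N)%N; apply: latP => l; have [z zE] := sP l; exists z.
have -> : (p%:R : k) ^+ (s + N) = (pi ^+ (s + N))%:A.
  by rewrite -[RHS]/(in_alg k _) rmorphXn /= (rmorph_nat iota) scaler_nat.
by rewrite mulr_algr linearZ /= exprD -zE; ring.
Qed.

End Lattice.

Lemma ext_square_classes :
  exists dk : seq k, forall a, a != 0 -> exists2 c, c != 0 & c ^+ 2 * a \in dk.
Proof.
have [N NP] := common_denominator
  (fun ijl : 'I_d * 'I_d * 'I_d => coord e ijl.2 (e`_ijl.1.1 * e`_ijl.1.2)).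
have NP' i j l := NP (i, j, l).
apply: (@finite_square_classes p p_pr k d (lat N)).
- exact: lat_inj.
- exact: lat_mul.
- exact: lat_denominator.
- exact: ext_char0.
Qed.

End PadicExtension.

Theorem corollary6p3 (p : nat) (p_pr : prime p)
    (k : fieldExtType (padic p_pr)) :
  property_FC (PGL 2 (laurent k)).
Proof.
have lpoly_inj := @lpoly_inj k; have unit_x := unit_lpolyX k.
have numer := @laurent_numer k.
have char0 n : (n.+1%:R : laurent k) != 0.
  by rewrite -(rmorph_nat (@lpoly k)) lpoly_eq0 // -polyC_natr polyC_eq0 ext_char0.
have unit2 : (2 : laurent k) \is a GRing.unit.
  rewrite -(rmorph_nat (@lpoly k)) -polyC_natr; apply: unit_C; exact: ext_char0 1.
have [dk dkP] := ext_square_classes k; have [tk tkP] := chebU_roots k.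
have [ds dsP] := laurent_mod_squares lpoly_inj numer unit_x dkP.
have [ts tsK tsP] := laurent_torsion_trace lpoly_inj numer unit_x tkP.
apply: (property_FC_PGL2 unit2 char0 _ _ _ _ tsK tsP dsP).
- exact: (unit_disc_conj lpoly_inj numer unit_x unit2).
- exact: constants_subring.
- exact: constants_unit.
- exact: (constants_sqrt lpoly_inj numer unit_x).
Qed.
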